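(* Let $d\ge 1$ and let $u_0:\mathbb{R}^d\to\mathbb{R}$ satisfy: $u_0\in C^{1,1}(\mathbb{R}^d)$, $\lim_{|x|\to\infty} u_0(x)/|x|=+\infty$, and there is $R_0>0$ such that $u_0=u_0^{**}$ outside $\overline{B}_{R_0}$. Let $$u(t,x):=\inf_{\sigma\,:\,|\sigma|\le 1}\ \mathbb{E}\Big(u_0\Big(x+\int_0^t\sqrt{2}\,\sigma_s\,dW_s\Big)\Big),\qquad t\ge 0,\ x\in\mathbb{R}^d.$$ Let $x_0\in\mathbb{R}^d$ and let $x(\cdot)$ be the solution on $[0,+\infty)$ of the Cauchy problem $$\dot x(t)=-\nabla u(t,x(t)),\quad t>0,\qquad x(0)=x_0.$$ Then $x(t)$ converges as $t\to\infty$ to some point $y_\infty\in\mathbb{R}^d$ that is a (global) minimizer of $u_0^{**}$.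
   Context: $\overline{B}_R$ is the closed Euclidean ball of radius $R$ centered at $0$ in $\mathbb{R}^d$. $C^{1,1}(\mathbb{R}^d)$ is the set of $C^1$ functions with (globally) Lipschitz gradient. $u_0^{**}$ is the convex envelope of $u_0$, i.e. the largest convex function on $\mathbb{R}^d$ that is everywhere $\le u_0$. $(W_s)_{s\ge0}$ is a standard $d$-dimensional Brownian motion; the infimum is over all $d\times d$-matrix-valued processes $\sigma$ adapted to the Brownian filtration (progressively measurable, so that the stochastic integral is defined) with $|\sigma_s|\le1$ for all $s$, where $|\sigma|:=\sqrt{\mathrm{Tr}(\sigma\sigma^T)}$. This $u$ is the continuous viscosity solution, with initial datum $u_0$ and agreeing with $u_0^{**}$ outside $B_{R_0}$ (the open ball), of $\partial_t u=\min(0,\lambda_1(D^2u))$, where $\lambda_1$ is the smallest eigenvalue. $\nabla$ denotes the gradient in $x$; under these assumptions $u(t,\cdot)$ is $C^{1,1}$ with a Lipschitz constant of the gradient uniform in $t$, and the Cauchy problem has a unique solution defined for all positive times. *)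

(* Defs.v *)
From HB Require Import structures.
From mathcomp Require Import all_boot all_order all_algebra.
From mathcomp Require Import all_classical all_reals all_analysis.

Set Implicit Arguments.
Unset Strict Implicit.
Unset Printing Implicit Defensive.

Import Order.TTheory GRing.Theory Num.Theory.
Import numFieldNormedType.Exports.

Local Open Scope classical_set_scope.
Local Open Scope ring_scope.

(* R^d is 'rV[R]_d. The library norm `|x| on 'rV[R]_d is the sup norm (it is
   only used for the topology); enorm is the Euclidean norm. *)
Section euclidean.
Context {R : realType} {d : nat}.
Implicit Types (f g v : 'rV[R]_d -> R) (x y : 'rV[R]_d).

Definition enorm x : R := Num.sqrt (\sum_(i < d) x 0 i ^+ 2).

Definition mxfrob (A : 'M[R]_d) : R := Num.sqrt (\tr (A *m A^T)).

(* Meaningful at points where f is differentiable. *)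
Definition grad f x : 'rV[R]_d := \row_(i < d) 'D_(delta_mx 0 i) f x.

Definition C11 f : Prop :=
  (forall x, differentiable f x) /\
  exists L : R, forall x y, enorm (grad f x - grad f y) <= L * enorm (x - y).

Definition superlinear f : Prop :=
  forall M : R, exists r : R, 0 < r /\ forall x, r < enorm x -> M < f x / enorm x.

Definition is_convex_envelope f v : Prop :=
  [/\ convex_function [set: 'rV[R]_d] v,
      (forall x, v x <= f x) &
      forall g, convex_function [set: 'rV[R]_d] g ->
        (forall x, g x <= f x) -> forall x, g x <= v x].

(* xi is a solution on [0, +oo[ of xi' = - grad_x u(t, xi), xi(0) = x0; that
   the gradient exists along the trajectory is part of being a solution. *)
Definition is_gradient_flow (u : R -> 'rV[R]_d -> R) x0 (xi : R -> 'rV[R]_d) :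
    Prop :=
  [/\ xi 0 = x0,
      {within `[0, +oo[, continuous xi} &
      forall t : R, 0 < t ->
        differentiable (u t) (xi t) /\
        is_derive t 1 xi (- grad (u t) (xi t))].

End euclidean.

(* Processes are indexed by all of R, but only their values at times s >= 0
   are ever used. *)
Section stochastic.
Context {R : realType} {d : nat} {disp : measure_display}
  {T : measurableType disp} (P : probability T R).
Implicit Types (W : R -> T -> 'rV[R]_d) (sigma : R -> T -> 'M[R]_d)
  (I : T -> 'rV[R]_d).

(* Events generating F_s = sigma(W_r, 0 <= r <= s). *)
Definition history W (s : R) : set (set T) :=
  [set A | exists (r : R) (i : 'I_d) (B : set R),
    [/\ 0 <= r <= s, measurable B & A = (fun w => W r w 0 i) @^-1` B]].

Record is_brownian W : Prop := IsBrownian {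
  brownian_measurable : forall (s : R) (i : 'I_d), 0 <= s ->
    measurable_fun [set: T] (fun w => W s w 0 i) ;
  brownian_start : {ae P, forall w, W 0 w = 0} ;
  brownian_continuous :
    {ae P, forall w, {within `[0, +oo[, continuous (W ^~ w)}} ;
  (* W_t - W_s is N(0, (t - s) Id) and independent of F_s; the second parameter
     of normal_prob is the standard deviation. *)
  brownian_increments : forall s t : R, 0 <= s -> s < t ->
    forall (B : set T) (A : 'I_d -> set R),
      <<s history W s >> B -> (forall i, measurable (A i)) ->
      P (B `&` [set w | forall i, A i (W t w 0 i - W s w 0 i)]) =
      (P B * \prod_(i < d) normal_prob 0 (Num.sqrt (t - s)) (A i))%E }.

(* sigma restricted to [0, t] x T is B([0, t]) (x) F_t-measurable for all t. *)
Definition progressively_measurable W sigma : Prop :=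
  forall t : R, 0 <= t -> forall i j : 'I_d,
    measurable_fun
      (`[0, t] `*` setT : set (R * g_sigma_algebraType (history W t)))
      (fun p => sigma p.1 p.2 i j).

(* Elementary process sum_(k < n) H_k 1_]s_k, s_(k+1)], with values in the
   d x d matrices. *)
Record elementary := Elementary {
  el_size : nat ;
  el_time : nat -> R ;
  el_coef : nat -> T -> 'M[R]_d }.

Definition is_elementary W (t : R) (e : elementary) : Prop :=
  [/\ el_time e 0%N = 0, el_time e (el_size e) = t,
      (forall k, (k < el_size e)%N -> el_time e k <= el_time e k.+1),
      (forall k (i j : 'I_d), (k < el_size e)%N ->
        measurable_fun [set: g_sigma_algebraType (history W (el_time e k))]
          (fun w => el_coef e k w i j)) &
      exists M : R, forall k w, (k < el_size e)%N -> mxfrob (el_coef e k w) <= M].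

Definition el_val (e : elementary) (s : R) (w : T) : 'M[R]_d :=
  \sum_(k < el_size e)
    if el_time e k < s <= el_time e k.+1 then el_coef e k w else 0.

(* sum_k H_k (W_(s_(k+1)) - W_(s_k)), transposed since vectors are rows. *)
Definition el_int W (e : elementary) (w : T) : 'rV[R]_d :=
  \sum_(k < el_size e)
    (W (el_time e k.+1) w - W (el_time e k) w) *m (el_coef e k w)^T.

(* I is (a version of) the Ito integral of sigma dW over [0, t]: the L^2 limit
   of the integrals of elementary processes converging to sigma in
   L^2(P (x) ds). *)
Definition is_ito_integral W sigma (t : R) I : Prop :=
  (forall i : 'I_d, measurable_fun [set: T] (fun w => I w 0 i)) /\
  exists e : nat -> elementary,
    [/\ forall n, is_elementary W t (e n),
        (\int[P]_w \int[lebesgue_measure]_(s in `[0%R, t])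
           (mxfrob (sigma s w - el_val (e n) s w) ^+ 2)%:E)%E
          @[n --> \oo] --> 0%E &
        (\int[P]_w (enorm (I w - el_int W (e n) w) ^+ 2)%:E)%E
          @[n --> \oo] --> 0%E].

Definition admissible W sigma : Prop :=
  progressively_measurable W sigma /\
  forall (s : R) w, 0 <= s -> mxfrob (sigma s w) <= 1.

(* inf over |sigma| <= 1 of E (u0 (x + int_0^t sqrt 2 sigma dW)). For u0
   continuous, bounded below and of at most quadratic growth the infimum is
   finite, so that fine does not lose information. *)
Definition value W (u0 : 'rV[R]_d -> R) (t : R) (x : 'rV[R]_d) : R :=
  fine (ereal_inf [set c : \bar R | exists sigma I,
    [/\ admissible W sigma,
        is_ito_integral W (fun s w => Num.sqrt 2 *: sigma s w) t I &
        c = ('E_P[fun w => u0 (x + I w)%R])%E]]).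

End stochastic.

(* Main.v *)
(* With v := u0cc and m := min v = min u0, everything rests on the estimate
   v <= u(t, .) <= v + C exp(- c t). The lower bound is Jensen's inequality. For
   the upper bound write v(x) as a barycenter of values u0(y_i), with the y_i in a
   fixed ball since u0 = v outside a ball, and control the state so that it stays
   the barycenter of the y_i under random weights whose mean is preserved while
   their variance decays exponentially. By semiconcavity
     u0 (sum a_i y_i) <= sum a_i u0(y_i) + L variance(a),
   so the expected cost is at most v(x) + C exp(- c t).
   Being an infimum of functions x |-> E u0(x + I), u(t, .) is semiconcave with the
   same constant L; combined with the estimate this gives, for all y,
     grad u(t, x) . (y - x) <= v(y) - v(x) + C exp(- c t / 2) (1 + |y - x|^2).
   Along the flow, 1 + |xi - y|^2 is then nonincreasing for every minimizer y of v
   up to an integrable factor, and v(xi) comes arbitrarily close to m. A cluster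
   point at which v = m is a minimizer, and the distance to it must tend to 0. *)
Require Import Defs.
From HB Require Import structures.
From mathcomp Require Import all_boot all_order all_algebra.
From mathcomp Require Import all_classical all_reals all_analysis.
From mathcomp Require Import measurable_realfun.
From mathcomp Require Import ring lra zify.
Set Implicit Arguments.
Unset Strict Implicit.
Unset Printing Implicit Defensive.
Import Order.TTheory GRing.Theory Num.Theory.
Import numFieldNormedType.Exports.
Local Open Scope classical_set_scope.
Local Open Scope ring_scope.

(** * Euclidean geometry and C11 functions *)

(** Exponential decay is what the flow needs: passing from the values to the gradients takes a
    square root of the estimate, and the result must be integrable in time. Moving the weights along
    the covariance without normalization would give a variance of order $1/t$, whose square root is
    not integrable; dividing by the standard deviation makes the decay geometric. The control is
    built directly as an elementary process. The weights move at finitely many times by multiples of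
    Brownian increments, so the state is exactly a barycenter at these times, its Ito integral is a
    finite sum, and the mean variance obeys an explicit recursion. The price is that Gaussian steps
    are unbounded: a path on which a weight becomes negative is frozen, and fourth moments bound the
    total cost of such paths by $O(N h^2)$, which vanishes when the step $h$ does at fixed $t = N
    h$. In the rate $c = 2 (\rho d)^{-2}/(3d)$, the 2 is the square of the factor $\sqrt 2$, the 1/3
    a crude lower bound on the normal variance, $(\rho d)^{-1}$ keeps the control in the unit ball,
    and the last $d$ comes from treating the coordinates one after the other. *)

Section dot_product.
Context {R : realType} {d : nat}.
Implicit Types (x y z : 'rV[R]_d) (a : R).

Definition dotv x y : R := \sum_(i < d) x 0 i * y 0 i.
Definition sqn x : R := dotv x x.

Lemma dotvC x y : dotv x y = dotv y x.
Proof. by apply: eq_bigr => i _; rewrite mulrC. Qed.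

Lemma dotvDr z x y : dotv z (x + y) = dotv z x + dotv z y.
Proof. by rewrite -big_split; apply: eq_bigr => i _; rewrite mxE mulrDr. Qed.

Lemma dotvZr a x y : dotv x (a *: y) = a * dotv x y.
Proof. by rewrite big_distrr; apply: eq_bigr => i _ /=; rewrite mxE mulrCA. Qed.

Lemma dotvDl x y z : dotv (x + y) z = dotv x z + dotv y z.
Proof. by rewrite dotvC dotvDr !(dotvC z). Qed.

Lemma dotvZl a x y : dotv (a *: x) y = a * dotv x y.
Proof. by rewrite dotvC dotvZr dotvC. Qed.

Lemma dotvNr x y : dotv x (- y) = - dotv x y.
Proof. by rewrite -scaleN1r dotvZr mulN1r. Qed.

Lemma dotvNl x y : dotv (- x) y = - dotv x y.
Proof. by rewrite dotvC dotvNr dotvC. Qed.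

Lemma dotv0r x : dotv x 0 = 0.
Proof. by rewrite -(scale0r x) dotvZr mul0r. Qed.

Lemma sqn_ge0 x : 0 <= sqn x.
Proof. by apply: sumr_ge0 => i _; rewrite -expr2 sqr_ge0. Qed.

Lemma sqn0 : sqn 0 = 0.
Proof. exact: dotv0r. Qed.

Lemma sqnZ a x : sqn (a *: x) = a ^+ 2 * sqn x.
Proof. by rewrite /sqn dotvZr dotvZl mulrA expr2. Qed.

Lemma sqnN x : sqn (- x) = sqn x.
Proof. by rewrite -scaleN1r sqnZ sqrrN expr1n mul1r. Qed.

Lemma sqnD x y : sqn (x + y) = sqn x + 2 * dotv x y + sqn y.
Proof. by rewrite /sqn dotvDr !dotvDl (dotvC y x); ring. Qed.

Lemma sqn_coord x i : x 0 i ^+ 2 <= sqn x.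
Proof.
rewrite /sqn /dotv (bigD1 i)//= -expr2 lerDl.
by apply: sumr_ge0 => j _; rewrite -expr2 sqr_ge0.
Qed.

Lemma enorm_sqn x : enorm x ^+ 2 = sqn x.
Proof.
rewrite sqr_sqrtr; first by apply: eq_bigr => i _; rewrite expr2.
by apply: sumr_ge0 => i _; rewrite sqr_ge0.
Qed.

Lemma enorm_ge0 x : 0 <= enorm x.
Proof. exact: sqrtr_ge0. Qed.

Lemma ltr_enorm a x : 0 <= a -> (a < enorm x) = (a ^+ 2 < sqn x).
Proof. by move=> a0; rewrite -enorm_sqn ltr_pXn2r// nnegrE enorm_ge0. Qed.

(** Used in place of Cauchy-Schwarz; the free weight [a] lets each use balance its two quadratic
    terms. *)
Lemma young_dotv a x y : 0 < a -> 2 * `|dotv x y| <= a * sqn x + a^-1 * sqn y.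
Proof.
move=> a0.
have := sqn_ge0 (a *: x + y); have := sqn_ge0 (a *: x - y).
rewrite !sqnD dotvNr sqnN sqnZ dotvZl => h1 h2.
have -> : a * sqn x + a^-1 * sqn y = a^-1 * (a ^+ 2 * sqn x + sqn y).
  by field; rewrite gt_eqF.
rewrite -(ler_pM2l a0) mulVKf ?gt_eqF//.
by case: (ger0P (dotv x y)) => _; lra.
Qed.

Lemma continuous_sqnB y : continuous (fun x => sqn (x - y)).
Proof.
rewrite /sqn /dotv; under eq_fun do under eq_bigr do rewrite !mxE.
have addc : continuous (fun p : R * R => p.1 + p.2) by exact: add_continuous.
apply: (@continuous_big R _ +%R 0 xpredT addc 'rV[R]_d _
  (fun i x => (x 0 i - y 0 i) * (x 0 i - y 0 i))) => i _ x.
have c : {for x, continuous (fun x : 'rV[R]_d => x 0 i - y 0 i)}.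
  by apply: continuousB; [exact: coord_continuous|exact: cst_continuous].
exact: (cvgM c c).
Qed.

End dot_product.

Section C11_functions.
Context {R : realType} {d : nat}.
Implicit Types (f u v : 'rV[R]_d -> R) (x y z k : 'rV[R]_d) (L C r s : R).

Lemma deriveE_grad f x k : differentiable f x -> 'D_k f x = dotv (grad f x) k.
Proof.
move=> df; rewrite deriveE// {1}(row_sum_delta k) linear_sum.
apply: eq_bigr => i _; rewrite linearZ mxE deriveE//= mulrC.
by [].
Qed.

Lemma is_derive_line f x k (s : R) : differentiable f (x + s *: k) ->
  is_derive s (1 : R) (fun s : R => f (x + s *: k)) (dotv (grad f (x + s *: k)) k).
Proof.
move=> df.
have dl : is_derive s (1 : R) (fun s : R => x + s *: k) k.
  have -> : (fun s : R => x + s *: k) = cst x + ( *:%R^~ k : R -> _) by [].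
  have ds : is_derive s (1 : R) ( *:%R^~ k : R -> 'rV[R]_d) (1 *: k).
    have ds := is_diff_scalel s k.
    by split; [exact/derivable1_diffP|rewrite deriveE// diff_val].
  by have := is_deriveD (is_derive_cst x s 1) ds; rewrite scale1r add0r.
have dl' : differentiable (fun s : R => x + s *: k) s.
  by apply/derivable1_diffP; exact: ex_derive.
split; first by apply/derivable1_diffP; exact: differentiable_comp.
rewrite deriveE; last exact: differentiable_comp.
rewrite diff_comp//= -[X in 'd f _ X]/('d (fun s : R => x + s *: k) s 1).
have [_ dlE] := dl.
have <- : 'D_1 (fun s : R => x + s *: k) s = 'd (fun s : R => x + s *: k) s 1.
  exact: deriveE.
by rewrite dlE -deriveE// deriveE_grad.
Qed.

(** Mean value theorem on the segment, then Young with weight $L^{-1}$. The upper half yields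
    semiconcavity of the value function and of the convex hull, the lower half compares [u0] at a
    barycenter with its values at the $y_i$. *)
Lemma C11_taylor f : C11 f -> exists2 L : R, 0 < L &
  forall x k, `|f (x + k) - f x - dotv (grad f x) k| <= L * sqn k.
Proof.
move=> [df [L0 lipf]].
(* The constant in [C11] need not be positive, and [L] will be inverted. *)
pose L : R := `|L0| + 1.
have L_gt0 : 0 < L by rewrite ltr_wpDl.
exists L => // x k.
have [c] : exists2 c, c \in `[0 : R, 1]%R &
    f (x + 1 *: k) - f (x + 0 *: k) = dotv (grad f (x + c *: k)) k * (1 - 0).
  apply: (@MVT_segment _ (fun s : R => f (x + s *: k))
    (fun s => dotv (grad f (x + s *: k)) k)) => //.
    by move=> s _; exact: is_derive_line.
  apply: continuous_subspaceT => s.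
  apply: differentiable_continuous; apply/derivable1_diffP.
  by have [] := is_derive_line (df (x + s *: k)).
rewrite in_itv/= => /andP[c0 c1].
rewrite scale1r scale0r addr0 subr0 mulr1 => ->.
rewrite -dotvNl -dotvDl.
have := young_dotv (grad f (x + c *: k) - grad f x) k (a := L^-1).
rewrite invr_gt0 invrK => /(_ L_gt0) h.
have : sqn (grad f (x + c *: k) - grad f x) <= L ^+ 2 * sqn k.
  rewrite -!enorm_sqn -exprMn ler_pXn2r ?nnegrE ?enorm_ge0 ?mulr_ge0 ?enorm_ge0 ?(ltW L_gt0)//.
  apply: (le_trans (lipf _ _)); rewrite [x + _]addrC addrK.
  have -> : enorm (c *: k) = c * enorm k.
    apply/eqP; rewrite -(@eqrXn2 _ 2)// ?mulr_ge0 ?enorm_ge0//.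
    by rewrite exprMn !enorm_sqn sqnZ.
  have := ler_norm L0; have := enorm_ge0 k; rewrite /L => ? ?.
  have : 0 <= c * enorm k by rewrite mulr_ge0.
  have : c * enorm k <= enorm k by rewrite ler_piMl.
  have := normr_ge0 L0; nra.
have Li : L^-1 * L ^+ 2 = L by field; rewrite gt_eqF.
move=> h2.
have : L^-1 * sqn (grad f (x + c *: k) - grad f x) <= L * sqn k.
  by rewrite -{2}Li -mulrA ler_pM2l ?invr_gt0.
by move: h; have := sqn_ge0 k; lra.
Qed.

Lemma taylor_ub f L x k :
  (forall x k, `|f (x + k) - f x - dotv (grad f x) k| <= L * sqn k) ->
  f (x + k) <= f x + dotv (grad f x) k + L * sqn k.
Proof. by move=> /(_ x k); rewrite ler_norml; lra. Qed.

Lemma taylor_lb f L x k :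
  (forall x k, `|f (x + k) - f x - dotv (grad f x) k| <= L * sqn k) ->
  f x + dotv (grad f x) k - L * sqn k <= f (x + k).
Proof. by move=> /(_ x k); rewrite ler_norml; lra. Qed.

(** [x] is the barycenter of the two other points with weights [r] and [s], so the gradient terms
    cancel. In this gradient-free form semiconcavity survives an infimum over controls. *)
Lemma taylor_three_points f L x k (r s : R) :
  (forall x k, `|f (x + k) - f x - dotv (grad f x) k| <= L * sqn k) ->
  0 < r -> 0 < s ->
  r * f (x - s *: k) + s * f (x + r *: k) <=
    (r + s) * f x + L * (r * s ^+ 2 + s * r ^+ 2) * sqn k.
Proof.
move=> fL r0 s0.
have := taylor_ub x (- (s *: k)) fL; have := taylor_ub x (r *: k) fL.
rewrite sqnN !sqnZ dotvNr !dotvZr => h1 h2.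
nra.
Qed.

Lemma taylor_growth f L :
  (forall x k, `|f (x + k) - f x - dotv (grad f x) k| <= L * sqn k) ->
  exists2 C : R, 0 < C & forall x, `|f x| <= C * (1 + sqn x).
Proof.
move=> fL; pose C : R := `|f 0| + sqn (grad f 0) + `|L| + 1.
have := normr_ge0 (f 0); have := normr_ge0 L => L0 f0.
have := sqn_ge0 (grad f 0) => g0.
exists C; first by rewrite /C; lra.
move=> x; have := fL 0 x; rewrite add0r.
have /(_ ltr01) := young_dotv (grad f 0) x (a := 1).
rewrite invr1 !mul1r => h1 h2.
have := sqn_ge0 x => x0.
have h3 : L * sqn x <= `|L| * sqn x by rewrite ler_wpM2r ?ler_norm.
have : `|f x| <= `|f 0| + `|dotv (grad f 0) x| + L * sqn x.
  have -> : f x = (f x - f 0 - dotv (grad f 0) x) + f 0 + dotv (grad f 0) x by lra.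
  apply: (le_trans (ler_normD _ _)).
  by have := ler_normD (f x - f 0 - dotv (grad f 0) x) (f 0); lra.
rewrite /C; nra.
Qed.

(** Divide by [r] and let [r] tend to 0: the near point turns into a directional derivative while
    the far one stays at distance [s]. Differentiability is thus needed at the single point [x]. *)
Lemma three_points_grad u L x k s :
  differentiable u x -> 0 < s ->
  (forall r, 0 < r -> r * u (x - s *: k) + s * u (x + r *: k) <=
    (r + s) * u x + L * (r * s ^+ 2 + s * r ^+ 2) * sqn k) ->
  u (x - s *: k) <= u x - s * dotv (grad u x) k + L * s ^+ 2 * sqn k.
Proof.
move=> du s0 h.
have : derivable u x k by exact: diff_derivable.
rewrite -deriveE_grad// /derivable /derive => /cvgrPdist_lt du'.
apply/ler_addgt0Pr => e e0.
(* $r M \le e/2$ makes the remainder $L s r |k|^2$ at most $e/2$; the difference quotient uses up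
   the other half. *)
pose M : R := 1 + `|L| * s * sqn k.
have Mge1 : 1 <= M.
  by rewrite lerDl mulr_ge0 ?sqn_ge0// mulr_ge0// ltW.
have /du' /nbhs_ballP[r0 /= r00 dr] : 0 < e / 2 / s by rewrite !divr_gt0.
pose r := Num.min (r0 / 2) (e / 2 / M).
have r_gt0 : 0 < r by rewrite lt_min !divr_gt0// (lt_le_trans _ Mge1).
have rM : r * M <= e / 2.
  by rewrite -ler_pdivlMr ?(lt_le_trans _ Mge1)// ge_min lexx orbT.
have rr0 : r < r0.
  by rewrite (@le_lt_trans _ _ (r0 / 2))// ?ge_min ?lexx// ltr_pdivrMr// ltr_pMr// ltr1n.
have /dr : ball (0 : R) r0 r by rewrite /ball/= sub0r normrN gtr0_norm.
move=> /(_ (lt0r_neq0 r_gt0)) /=.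
rewrite -/(derive _ _ _) [r *: k + x]addrC ltr_norml => /andP[_ +].
rewrite /GRing.scale/= ltrBlDr => h1.
have := h r r_gt0.
have : r * ('D_k u x - e / 2 / s) <= u (x + r *: k) - u x.
  rewrite -[leRHS](mulVKf (lt0r_neq0 r_gt0)) ler_pM2l// ltW//.
  by move: h1; rewrite /derive; lra.
move=> h2 h3.
have : s * (r * ('D_k u x - e / 2 / s)) <= s * (u (x + r *: k) - u x) by rewrite ler_pM2l.
have -> : s * (r * ('D_k u x - e / 2 / s)) = r * (s * 'D_k u x - e / 2).
  by field; rewrite gt_eqF.
move=> h4; rewrite -(ler_pM2l r_gt0).
have h5 : r * (L * s * r * sqn k) <= r * (e / 2).
  rewrite ler_pM2l//; apply: le_trans rM.
  have : L * s * sqn k <= M.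
    have := ler_norm L; have := sqn_ge0 k => k0 L0.
    have : L * (s * sqn k) <= `|L| * (s * sqn k) by rewrite ler_wpM2r// mulr_ge0// ltW.
    rewrite /M; lra.
  by move=> /(ler_wpM2l (ltW r_gt0)); lra.
by rewrite -/(derive u x k); lra.
Qed.

End C11_functions.

(** * The convex envelope *)

Section convex_hull_of_graph.
Context {R : realType} {d : nat}.
Implicit Types (f v : 'rV[R]_d -> R) (x y z k : 'rV[R]_d) (B : set 'rV[R]_d)
  (L C r s t rho : R).

Lemma convex_function_lerP v :
  convex_function [set: 'rV[R]_d] v <->
  forall x y t, 0 <= t -> t <= 1 ->
    v (t *: x + (1 - t) *: y) <= t * v x + (1 - t) * v y.
Proof.
split=> [cv x y t t0 t1|h t x y _ _].
  have xT z : z \in [set: 'rV[R]_d] by rewrite inE.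
  exact: (cv (Itv01 t0 t1) x y).
by apply: h; [exact: ge0|exact: le1].
Qed.

(* Convex hull of the epigraph of f restricted to B, generated by two-point
   combinations so that no finite families occur before hull_epi_finite. *)
Inductive hull_epi f B : 'rV[R]_d -> R -> Prop :=
| hull_base x r : B x -> f x <= r -> hull_epi f B x r
| hull_conv x1 x2 r1 r2 t : 0 <= t -> t <= 1 ->
    hull_epi f B x1 r1 -> hull_epi f B x2 r2 ->
    hull_epi f B (t *: x1 + (1 - t) *: x2) (t * r1 + (1 - t) * r2).

Lemma hull_epi_le f B x r r' : hull_epi f B x r -> r <= r' -> hull_epi f B x r'.
Proof.
move=> h rr'; have -> : x = x + 0 by rewrite addr0.
elim: h r' rr' => {x r} [x r Bx fr|x1 x2 r1 r2 t t0 t1 h1 ih1 h2 ih2] r' rr'.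
  by rewrite addr0; apply: hull_base => //; exact: le_trans rr'.
rewrite addr0.
(* Both heights are raised by the same amount. *)
have -> : r' = t * (r1 + (r' - (t * r1 + (1 - t) * r2))) +
    (1 - t) * (r2 + (r' - (t * r1 + (1 - t) * r2))) by ring.
rewrite -[x1]addr0 -[x2]addr0.
by apply: hull_conv => //; [apply: ih1|apply: ih2]; lra.
Qed.

Lemma hull_epi_ge f v B x r : convex_function [set: 'rV[R]_d] v ->
  (forall x, B x -> v x <= f x) -> hull_epi f B x r -> v x <= r.
Proof.
move=> /convex_function_lerP cv vf; elim=> {x r} [x r Bx|].
  by apply: le_trans; exact: vf.
move=> x1 x2 r1 r2 t t0 t1 _ h1 _ h2; apply: (le_trans (cv _ _ _ t0 t1)).
by rewrite lerD// ler_wpM2l// subr_ge0.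
Qed.

(** Translate every generator by [k] and use its Taylor majorant. All majorants share the term
    $L|k|^2$, so it passes unchanged through convex combinations and only the slopes are
    averaged. *)
Lemma hull_epi_taylor f L x r :
  (forall x k, `|f (x + k) - f x - dotv (grad f x) k| <= L * sqn k) ->
  hull_epi f setT x r ->
  exists p, forall k, hull_epi f setT (x + k) (r + dotv p k + L * sqn k).
Proof.
move=> fL; elim=> {x r} [x r _ fr|x1 x2 r1 r2 t t0 t1 _ [p1 h1] _ [p2 h2]].
  exists (grad f x) => k; apply: hull_base => //.
  by have := taylor_ub x k fL; lra.
exists (t *: p1 + (1 - t) *: p2) => k.
have -> : t *: x1 + (1 - t) *: x2 + k = t *: (x1 + k) + (1 - t) *: (x2 + k).
  by apply/rowP => i; rewrite !mxE; ring.
have -> : t * r1 + (1 - t) * r2 + dotv (t *: p1 + (1 - t) *: p2) k + L * sqn k =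
   t * (r1 + dotv p1 k + L * sqn k) + (1 - t) * (r2 + dotv p2 k + L * sqn k).
  by rewrite dotvDl !dotvZl; ring.
exact: hull_conv.
Qed.

(** The lower boundary [g] of the hull is a convex minorant of [f], hence below [v] by maximality.
    The bound [m] keeps [g] finite, and [e] is there because the infimum may not be attained. *)
Lemma envelope_hull_epi f v m : (forall x, m <= f x) ->
  is_convex_envelope f v ->
  forall x e, 0 < e -> hull_epi f setT x (v x + e).
Proof.
move=> mf [_ _ vmax] x e e0.
pose g x := inf [set r | hull_epi f setT x r].
have mhull y r : hull_epi f setT y r -> m <= r.
  apply: (@hull_epi_ge f (cst m)) => //.
  by apply/convex_function_lerP => ? ? t _ _ /=; lra.
have ginf y : has_inf [set r | hull_epi f setT y r].
  split; first by exists (f y); exact: hull_base.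
  by exists m => r; exact: mhull.
have glb y r : hull_epi f setT y r -> g y <= r.
  by move=> h; apply: ge_inf => //; case: (ginf y).
have gapp y (z : R) : 0 < z -> hull_epi f setT y (g y + z).
  move=> z0; have [r hr /ltW rz] := inf_adherent z0 (ginf y).
  exact: hull_epi_le hr rz.
have cg : convex_function [set: 'rV[R]_d] g.
  apply/convex_function_lerP => y z t t0 t1; apply/ler_addgt0Pr => c c0.
  apply: glb.
  have -> : t * g y + (1 - t) * g z + c = t * (g y + c) + (1 - t) * (g z + c) by ring.
  by apply: hull_conv => //; exact: gapp.
have gf y : g y <= f y by apply: glb; exact: hull_base.
apply: hull_epi_le (gapp x _ e0) _.
by rewrite lerD2r; exact: vmax.
Qed.

(** [v] has a quadratic majorant of slope [p] at [x], and convexity on the segment from $x - sk$ to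
    $x + k$ reflects it into a minorant of the same slope. This does the work of a separation
    theorem up to an error that Jensen and lower semicontinuity tolerate. *)
Lemma envelope_subgradient f v m L : 0 < L -> (forall x, m <= f x) ->
  (forall x k, `|f (x + k) - f x - dotv (grad f x) k| <= L * sqn k) ->
  is_convex_envelope f v ->
  forall x e, 0 < e ->
    exists p, forall k, v x + dotv p k - e * (1 + sqn k) <= v (x + k).
Proof.
move=> L0 mf fL env x e e0; have [cv vf _] := env.
(* After division by [s] the errors are $es/s$ and $Ls|k|^2$; this choice gives both the coefficient
   [e]. *)
pose s := e / L.
have s0 : 0 < s by rewrite divr_gt0.
have es0 : 0 < e * s by rewrite mulr_gt0.
have [p hp] := hull_epi_taylor fL (envelope_hull_epi mf env x es0).
exists p => k.
have := hull_epi_ge cv (fun x _ => vf x) (hp (- (s *: k))).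
rewrite sqnN sqnZ dotvNr dotvZr => h1.
have s1 : 0 < 1 + s by rewrite addr_gt0.
move/convex_function_lerP : cv => /(_ (x - s *: k) (x + k) (1 + s)^-1).
rewrite invr_ge0 (ltW s1) invf_le1// lerDl (ltW s0) => /(_ isT isT).
have -> : (1 + s)^-1 *: (x - s *: k) + (1 - (1 + s)^-1) *: (x + k) = x.
  by apply/rowP => i; rewrite !mxE; field; rewrite gt_eqF.
rewrite -(ler_pM2l s1).
have -> : (1 + s) * ((1 + s)^-1 * v (x - s *: k) + (1 - (1 + s)^-1) * v (x + k)) =
  v (x - s *: k) + s * v (x + k) by field; rewrite gt_eqF.
move=> h2; rewrite -(ler_pM2l s0).
have Ls : L * (s ^+ 2 * sqn k) = s * e * sqn k by rewrite /s; field; rewrite gt_eqF.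
by move: h1; rewrite Ls; nra.
Qed.


Lemma sphere_crossing x y rho : 0 < rho -> rho < enorm x -> enorm y <= rho ->
  exists2 a, 0 < a <= 1 & enorm (x + a *: (y - x)) = rho.
Proof.
move=> rho0 xrho yrho.
pose phi a := sqn ((x + a *: (y - x)) - 0).
have cphi : {within `[0 : R, 1], continuous phi}.
  apply: continuous_subspaceT => a.
  apply: (@continuous_comp _ _ _ (fun a : R => x + a *: (y - x)) (fun z => sqn (z - 0))).
    apply: continuousD; first exact: cst_continuous.
    exact: scalel_continuous.
  exact: continuous_sqnB.
have phi0 : phi 0 = sqn x by rewrite /phi scale0r addr0 subr0.
have phi1 : phi 1 = sqn y by rewrite /phi scale1r subr0 [x + _]addrC subrK.
have xr : rho ^+ 2 < sqn x by rewrite -ltr_enorm// ltW.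
have yr : sqn y <= rho ^+ 2.
  by rewrite -enorm_sqn ler_pXn2r// nnegrE ?enorm_ge0// ltW.
have [|a] := IVT ler01 cphi (v := rho ^+ 2).
  by rewrite phi0 phi1 ge_min le_max yr (ltW xr) orbT.
rewrite in_itv/= => /andP[a0 a1] pa; exists a.
  rewrite a1 andbT lt_neqAle a0 andbT; apply/eqP => a00.
  by move: pa xr; rewrite -a00 phi0 => ->; rewrite ltxx.
apply/eqP; rewrite -(@eqrXn2 _ 2)// ?enorm_ge0 ?(ltW rho0)//.
by rewrite enorm_sqn -pa /phi subr0.
Qed.

(* Outside the ball f is its own convex envelope, so the part of a chord that
   leaves the ball may be cut off where it crosses the sphere. *)
Lemma hull_epi_cut f v rho x x1 x2 r1 r2 t :
  convex_function [set: 'rV[R]_d] v -> 0 < rho ->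
  (forall y, rho <= enorm y -> f y = v y) ->
  x = t *: x1 + (1 - t) *: x2 -> 0 <= t -> t <= 1 ->
  enorm x <= rho -> v x1 <= r1 -> v x2 <= r2 ->
  (enorm x1 <= rho -> hull_epi f [set y | enorm y <= rho] x1 r1) ->
  exists x1' r1' t', [/\ x = t' *: x1' + (1 - t') *: x2, 0 <= t' <= 1,
    t' * r1' + (1 - t') * r2 <= t * r1 + (1 - t) * r2,
    v x1' <= r1' & hull_epi f [set y | enorm y <= rho] x1' r1'].
Proof.
move=> /convex_function_lerP cv rho0 fv xE t0 t1 xrho vr1 vr2 h1.
have [x1rho|x1rho] := lerP (enorm x1) rho.
  by exists x1, r1, t; split => //; [exact/andP|exact: h1].
have [a /andP[a0 a1] za] := sphere_crossing rho0 x1rho xrho.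
pose z := x1 + a *: (x - x1).
have fz : f z = v z by rewrite fv// za.
have vx : v x <= t * r1 + (1 - t) * r2.
  rewrite xE; apply: (le_trans (cv _ _ _ t0 t1)).
  by rewrite lerD// ler_wpM2l// subr_ge0.
have vz : v z <= (1 - a) * r1 + a * (t * r1 + (1 - t) * r2).
  have -> : z = a *: x + (1 - a) *: x1.
    by apply/rowP => i; rewrite /z !mxE; ring.
  apply: (le_trans (cv _ _ _ (ltW a0) a1)).
  rewrite addrC lerD// ler_wpM2l// ?subr_ge0//; exact: ltW.
(* For [a = 1] the crossing point [z] is [x] itself; apart, because [D] below would vanish if also
   [t = 0]. *)
have [a1'|an1] := eqVneq a 1.
  exists z, (v z), 1; split => //.
  - by rewrite subrr scale0r scale1r addr0 /z a1' scale1r addrC subrK.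
  - by rewrite ler01 lexx.
  - by move: vz; rewrite a1'; lra.
  - by apply: hull_base; [rewrite /= za|rewrite fz].
(* Eliminating [x1] between the barycentric expressions of [x] and [z] gives $D x = t z + (1-t)(1-a)
   x_2$. *)
pose D := (1 - t) * (1 - a) + t.
have D0 : 0 < D.
  have a1' : a < 1 by rewrite lt_neqAle an1.
  have := mulr_ge0 (ltW a0) t0; rewrite /D; lra.
have D0' : (1 - t) * (1 - a) + t != 0 by rewrite gt_eqF.
exists z, (v z), (t / D).
have xz : D *: x = t *: z + ((1 - t) * (1 - a)) *: x2.
  by rewrite /D /z xE; apply/rowP => i; rewrite !mxE; ring.
have tD : t <= D.
  by rewrite /D lerDr mulr_ge0// subr_ge0.
split.
- apply: (scalerI (D0' : D != 0)); rewrite xz.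
  by apply/rowP => i; rewrite !mxE /D; field.
- by rewrite divr_ge0 ?(ltW D0)//= ler_pdivrMr// mul1r.
- rewrite -(ler_pM2l D0).
  have -> : D * (t / D * v z + (1 - t / D) * r2) = t * v z + (D - t) * r2.
    by rewrite /D; field.
  have : t * v z <= t * ((1 - a) * r1 + a * (t * r1 + (1 - t) * r2)) by rewrite ler_wpM2l.
  by rewrite /D; lra.
- by [].
- by apply: hull_base; [rewrite /= za|rewrite fz].
Qed.

(** The chord is cut at one end, then at the other with the endpoints exchanged. An endpoint already
    in the ball is handled by its induction hypothesis, any other by the cut. *)
Lemma hull_epi_ball f v rho x r :
  convex_function [set: 'rV[R]_d] v -> 0 < rho -> (forall y, v y <= f y) ->
  (forall y, rho <= enorm y -> f y = v y) ->
  hull_epi f setT x r -> enorm x <= rho ->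
  hull_epi f [set y | enorm y <= rho] x r.
Proof.
move=> cv rho0 vf fv; elim=> {x r} [x r _ fr xrho|]; first exact: hull_base.
move=> x1 x2 r1 r2 t t0 t1 h1 ih1 h2 ih2 xrho.
have v1 := hull_epi_ge cv (fun x _ => vf x) h1.
have v2 := hull_epi_ge cv (fun x _ => vf x) h2.
have [y1 [s1 [t' [E1 /andP[t'0 t'1] le1 w1 k1]]]] :=
  hull_epi_cut cv rho0 fv erefl t0 t1 xrho v1 v2 ih1.
have E1' : t *: x1 + (1 - t) *: x2 = (1 - t') *: x2 + (1 - (1 - t')) *: y1.
  by rewrite E1 addrC; congr (_ + _ *: _); ring.
have t'2 : 0 <= 1 - t' by rewrite subr_ge0.
have t'3 : 1 - t' <= 1 by lra.
have [y2 [s2 [t2 [E2 /andP[t20 t21] le2 w2 k2]]]] :=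
  hull_epi_cut cv rho0 fv E1' t'2 t'3 xrho v2 w1 ih2.
by rewrite E2; apply: hull_epi_le (hull_conv t20 t21 k2 k1) _; lra.
Qed.

(** The index types grow as disjoint sums. No bound on their size is required, since the final
    estimate depends on the points only through the radius of a ball containing them. *)
Lemma hull_epi_finite f B x r : hull_epi f B x r ->
  exists (I : finType) (lam : I -> R) (y : I -> 'rV[R]_d),
    [/\ forall i, 0 <= lam i, \sum_i lam i = 1, forall i, B (y i),
      \sum_i lam i *: y i = x & \sum_i lam i * f (y i) <= r].
Proof.
elim=> {x r} [x r Bx fr|x1 x2 r1 r2 t t0 t1 _ [I1 [l1 [y1 [p1 s1 B1 e1 f1]]]]
    _ [I2 [l2 [y2 [p2 s2 B2 e2 f2]]]]].
  exists unit, (fun=> 1), (fun=> x).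
  have sum_unit (V : nmodType) (F : unit -> V) : \sum_i F i = F tt.
    by rewrite (bigD1 tt)//= big1 ?addr0// => -[].
  by split => //; rewrite !sum_unit// ?scale1r// mul1r.
exists (I1 + I2)%type, (fun i => match i with
  inl i => t * l1 i | inr i => (1 - t) * l2 i end),
  (fun i => match i with inl i => y1 i | inr i => y2 i end).
split.
- by case=> i; rewrite mulr_ge0// subr_ge0.
- by rewrite big_sumType/= -!mulr_sumr s1 s2; ring.
- by case.
- rewrite big_sumType/= -e1 -e2 !scaler_sumr.
  by congr (_ + _); apply: eq_bigr => i _; rewrite scalerA.
- rewrite big_sumType/= (eq_bigr (fun i => t * (l1 i * f (y1 i)))); last first.
    by move=> i _; rewrite mulrA.
  rewrite [X in _ + X](eq_bigr (fun i => (1 - t) * (l2 i * f (y2 i)))); last first.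
    by move=> i _; rewrite mulrA.
  by rewrite -!mulr_sumr lerD// ler_wpM2l// subr_ge0.
Qed.

End convex_hull_of_graph.

(** * Perturbed gradient flows of convex functions *)

Section perturbed_convex_flow.
Context {R : realType} {d : nat}.
Implicit Types (f v : 'rV[R]_d -> R) (x y z k : 'rV[R]_d).

Lemma compact_coord_box (rho : R) :
  compact [set x : 'rV[R]_d | forall i, `|x 0 i| <= rho].
Proof.
have -> : [set x : 'rV[R]_d | forall i, `|x 0 i| <= rho] =
    [set x | forall i, (fun=> `[- rho, rho]%classic) i (x ord0 i)].
  by apply/seteqP; split => x /= h i; have := h i; rewrite in_itv/= ler_norml.
apply: (@rV_compact R d (fun=> `[- rho, rho]%classic)) => _.
exact: segment_compact.
Qed.

Lemma sqn_lt_cvg (xi : R -> 'rV[R]_d) y :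
  (forall e, 0 < e -> exists t0, forall t, t0 <= t -> sqn (xi t - y) < e) ->
  xi t @[t --> +oo] --> y.
Proof.
move=> h; apply/cvgrPdist_lt => e e0.
have [t0 ht0] := h (e ^+ 2) (exprn_gt0 2 e0).
near=> t.
have /ht0 tt : t0 <= t by near: t; apply: nbhs_pinfty_ge; exact: num_real.
rewrite distrC {1}/Num.norm/= mx_normrE.
apply: bigmax_lt => // -[i j] _ /=; rewrite ord1.
rewrite -(@ltr_pXn2r _ 2)// ?nnegrE ?(ltW e0)//.
rewrite real_normK ?num_real//.
exact: le_lt_trans (sqn_coord _ _) tt.
Unshelve. all: by end_near. Qed.

Variables (v : 'rV[R]_d -> R) (xi g : R -> 'rV[R]_d) (y0 : 'rV[R]_d) (K lam : R).
Hypotheses (K0 : 0 < K) (lam0 : 0 < lam).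
Hypothesis v_min : forall z, v y0 <= v z.
Hypothesis v_lsc : forall x e, 0 < e ->
  exists p, forall k, v x + dotv p k - e * (1 + sqn k) <= v (x + k).
Hypothesis xi_flow : forall t : R, 0 < t -> is_derive t 1 xi (- g t).
Hypothesis g_subgrad : forall t y, 0 < t ->
  dotv (g t) (y - xi t) <= v y - v (xi t) + K * expR (- lam * t) * (1 + sqn (y - xi t)).

Let corr (t : R) : R := expR (2 * K / lam * expR (- lam * t)).
(* The factor absorbs the integrable perturbation, so that Psi decreases. *)
Let Psi y (t : R) : R := (1 + sqn (xi t - y)) * corr t.

Let corr_ge1 t : 1 <= corr t.
Proof.
rewrite /corr -expR0 ler_expR; apply: mulr_ge0; last exact: expR_ge0.
by rewrite divr_ge0 ?mulr_ge0 ?ltW.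
Qed.

Let is_derive_sqn y (t : R) : 0 < t ->
  is_derive t (1 : R) (fun t => sqn (xi t - y)) (2 * dotv (g t) (y - xi t)).
Proof.
move=> t0; have [dxi xiE] := xi_flow t0.
have dc i : is_derive t 1 (fun t => xi t 0 i) (- g t 0 i).
  have dxi' := (derivable_mxP _ _ _).1 dxi.
  split; first exact: dxi'.
  by have := derive_mx dxi; rewrite xiE => /matrixP/(_ 0 i); rewrite !mxE.
have -> : (fun t => sqn (xi t - y)) =
    \sum_(i < d) (fun t => (xi t 0 i - y 0 i) ^+ 2).
  by apply/funext => s; rewrite fct_sumE; apply: eq_bigr => i _; rewrite !mxE expr2.
have -> : 2 * dotv (g t) (y - xi t) =
    \sum_(i < d) (2 * (xi t 0 i - y 0 i) * (- g t 0 i)).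
  by rewrite /dotv big_distrr/=; apply: eq_bigr => i _; rewrite !mxE; ring.
apply: is_derive_sum => i.
have db := is_deriveB (dc i) (is_derive_cst (y 0 i) t 1).
have := is_deriveX 2 db.
set w := (X in is_derive _ _ _ X -> _) => h.
have -> : 2 * (xi t 0 i - y 0 i) * - g t 0 i = w.
  by rewrite /w /GRing.scale/= subr0 expr1 mulrC.
exact: h.
Qed.

Let is_derive_corr (t : R) :
  is_derive t (1 : R) corr (- (2 * K) * expR (- lam * t) * corr t).
Proof.
have d1 : is_derive t (1 : R) (fun t : R => - lam * t) (- lam).
  by have := is_deriveZ (- lam) (is_derive_id t (1 : R)); rewrite /GRing.scale/= mulr1.
have d2 := is_derive1_comp (is_derive_expR (- lam * t)) d1.
have d3 : is_derive t (1 : R) (fun t : R => 2 * K / lam * expR (- lam * t))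
    (2 * K / lam * (expR (- lam * t) * - lam)) := is_deriveZ (2 * K / lam) d2.
have := @is_derive1_comp _ expR (fun t : R => 2 * K / lam * expR (- lam * t))
  t _ _ (is_derive_expR _) d3.
set w := (X in is_derive _ _ _ X -> _) => h.
have -> : - (2 * K) * expR (- lam * t) * corr t = w.
  by rewrite /w /corr; field; rewrite gt_eqF.
exact: h.
Qed.

(** The logarithmic derivative of [corr] is $-2K e^{-\lambda t}$, which cancels the perturbation in
    [g_subgrad] exactly. What remains is the gap of [v], multiplied by [corr], which is at least
    1. *)
Let Psi_decr y s t : (forall z, v y <= v z) -> 0 < s -> s <= t ->
  exists2 c, s <= c <= t & Psi y t - Psi y s <= - 2 * (v (xi c) - v y) * (t - s).
Proof.
move=> ymin s0 st.
pose dP c := (1 + sqn (xi c - y)) * (- (2 * K) * expR (- lam * c) * corr c) +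
  corr c * (2 * dotv (g c) (y - xi c)).
have dPsi (c : R) : 0 < c -> is_derive c (1 : R) (Psi y) (dP c).
  move=> c0.
  have d1 : is_derive c (1 : R) (fun t => 1 + sqn (xi t - y))
      (2 * dotv (g c) (y - xi c)).
    have := is_deriveD (is_derive_cst (1 : R) c (1 : R)) (is_derive_sqn y c0).
    by rewrite add0r.
  exact: (is_deriveM d1 (is_derive_corr c)).
have cPsi : {within `[s, t], continuous (Psi y)}.
  apply: continuous_in_subspaceT => c; rewrite inE/= in_itv/= => /andP[sc _].
  apply: differentiable_continuous; apply/derivable1_diffP.
  by have [] := dPsi c (lt_le_trans s0 sc).
have [||c] := @MVT_segment _ (Psi y) dP s t st => //.
  move=> c; rewrite in_itv/= => /andP[/ltW sc _].
  exact: dPsi (lt_le_trans s0 sc).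
rewrite in_itv/= => /andP[sc ct] ->; exists c; first by rewrite sc.
rewrite ler_wpM2r ?subr_ge0// /dP.
have := g_subgrad y (lt_le_trans s0 sc).
rewrite -[y - xi c]opprB sqnN.
set G := dotv _ _; set S := sqn _; set E := expR _ => h.
have := corr_ge1 c; have := ymin (xi c) => h1 h2.
have h3 : corr c * G <= corr c * (v y - v (xi c) + K * E * (1 + S)).
  by rewrite ler_wpM2l// (le_trans ler01).
have h4 : v (xi c) - v y <= corr c * (v (xi c) - v y).
  by rewrite ler_peMl// subr_ge0.
lra.
Qed.

Let Psi_nincr y s t : (forall z, v y <= v z) -> 0 < s -> s <= t ->
  Psi y t <= Psi y s.
Proof.
move=> ymin s0 st; have [c _ h] := Psi_decr ymin s0 st.
rewrite -subr_le0; apply: (le_trans h).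
by rewrite mulr_le0_ge0 ?subr_ge0// mulr_le0_ge0 ?subr_ge0// oppr_le0.
Qed.

Let sqn_Psi y t : sqn (xi t - y) <= Psi y t.
Proof.
have := corr_ge1 t; have := sqn_ge0 (xi t - y); rewrite /Psi; nra.
Qed.

(** A gap of [v] that stayed bounded below would make [Psi y0] decrease linearly, although it is
    nonnegative. *)
Let near_min n : exists t, n.+1%:R <= t /\ v (xi t) <= v y0 + n.+1%:R^-1.
Proof.
apply: contrapT => h.
have far t : n.+1%:R <= t -> n.+1%:R^-1 <= v (xi t) - v y0.
  move=> nt; rewrite leNgt; apply/negP => h'.
  by apply: h; exists t; split => //; rewrite -lerBlDl ltW.
pose A := Psi y0 n.+1%:R.
have n0 : (0 : R) < n.+1%:R by [].
have A0 : 0 <= A by apply: le_trans (sqn_Psi _ _); exact: sqn_ge0.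
(* Over this duration a gap of $1/(n+1)$ lowers [Psi] by $2(A+1)$, more than its initial value
   [A]. *)
pose t := n.+1%:R + n.+1%:R * (A + 1).
have nt : n.+1%:R <= t by rewrite lerDl mulr_ge0 ?ltW// ltr_wpDl.
have [c /andP[nc _] hc] := Psi_decr v_min n0 nt.
have ht : t - n.+1%:R = n.+1%:R * (A + 1) by rewrite /t addrC addKr.
have : n.+1%:R^-1 * (n.+1%:R * (A + 1)) <= (v (xi c) - v y0) * (t - n.+1%:R).
  by rewrite ht ler_wpM2r ?far// mulr_ge0 ?ltW// ltr_wpDl.
rewrite mulKf ?gt_eqF// => h1.
have := sqn_Psi y0 t; have := sqn_ge0 (xi t - y0); move: hc; rewrite -/A; lra.
Qed.

(** Closeness to [y] and near-minimality have to hold at the same time [t], because [v] is only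
    known to be lower semicontinuous. *)
Let cluster_point : exists y, forall e n, 0 < e ->
  exists2 t, n%:R <= t & sqn (xi t - y) < e /\ v (xi t) <= v y0 + e.
Proof.
have [tn htn] := choice near_min.
pose A := Psi y0 1.
have inbox n : forall i, `|xi (tn n) 0 i| <= A + 1 + \sum_j `|y0 0 j|.
  move=> i.
  have [nt _] := htn n.
  have t1 : 1 <= tn n by rewrite (le_trans _ nt)// ler1n.
  have : (xi (tn n) - y0) 0 i ^+ 2 <= A.
    apply: (le_trans (sqn_coord _ _)); apply: (le_trans (sqn_Psi _ _)).
    exact: Psi_nincr.
  rewrite !mxE => h.
  have h1 : `|xi (tn n) 0 i - y0 0 i| <= A + 1.
    have := sqr_ge0 (`|xi (tn n) 0 i - y0 0 i| - 1).
    by have := real_normK (num_real (xi (tn n) 0 i - y0 0 i)); nra.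
  have h2 : `|y0 0 i| <= \sum_j `|y0 0 j|.
    by rewrite (bigD1 i)//= lerDl sumr_ge0.
  have := ler_normD (xi (tn n) 0 i - y0 0 i) (y0 0 i); rewrite subrK; lra.
have [|y [_ cly]] := @compact_coord_box (A + 1 + \sum_j `|y0 0 j|)
    ((fun n => xi (tn n)) @ \oo) _.
  by exists 0%N => // n _; exact: inbox.
exists y => e n e0.
(* From [N] on, the times [tn k] exceed [n] and the gaps $1/(k+1)$ are below [e]. *)
pose N := maxn n (Num.truncn e^-1).
have nA : ((fun n => xi (tn n)) @ \oo) [set xi (tn k) | k in [set k | (N <= k)%N]].
  by exists N => // k /= Nk; exists k.
have nB : nbhs y [set z | sqn (z - y) < e].
  have := @continuous_sqnB R d y y.
  move=> /cvgrPdist_lt/(_ e e0); apply: filterS => z /=.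
  rewrite subrr sqn0 sub0r normrN => h.
  by apply: le_lt_trans h; exact: ler_norm.
have [z [[k Nk <-] hk]] := cly _ _ nA nB.
have [nt vt] := htn k.
exists (tn k).
  by apply: le_trans nt; rewrite ler_nat leqW// (leq_trans _ Nk)// leq_maxl.
split => //; apply: (le_trans vt); rewrite lerD2l.
rewrite -[leRHS]invrK lef_pV2 ?posrE ?invr_gt0//.
apply: ltW; apply: (lt_le_trans (truncnS_gt _)).
by rewrite ler_nat ltnS (leq_trans _ Nk)// leq_maxr.
Qed.

Lemma perturbed_convex_flow_cvg :
  exists y, (xi t @[t --> +oo] --> y) /\ (forall z, v y <= v z).
Proof.
have [y hy] := cluster_point; exists y.
have vy : v y <= v y0.
  (* One [e] for the gap of [v], one for the linear term, and two for $e(1+|k|^2)$ with $|k| \le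
     1$. *)
  apply/ler_addgt0Pr => e0 e00; pose e := e0 / 4.
  have e_gt0 : 0 < e by rewrite divr_gt0.
  have [p hp] := v_lsc y e_gt0.
  pose a := e / (sqn p + 1).
  have p1 : 0 < sqn p + 1 by rewrite ltr_wpDl// sqn_ge0.
  have a0 : 0 < a by rewrite divr_gt0.
  pose e1 := Num.min 1 (Num.min e (e * a)).
  have e10 : 0 < e1 by rewrite !lt_min ltr01 e_gt0 mulr_gt0.
  have [t _ [ht hvt]] := hy e1 0%N e10.
  have := hp (xi t - y); rewrite [y + _]addrC subrK.
  have e11 : e1 <= 1 by rewrite ge_min lexx.
  have e12 : e1 <= e by rewrite !ge_min lexx orbT.
  have e13 : e1 <= e * a by rewrite !ge_min lexx !orbT.
  have := young_dotv p (xi t - y) a0.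
  have h1 : a * sqn p <= e.
    rewrite /a mulrAC ler_pdivrMr// ler_wpM2l ?(ltW e_gt0)//; lra.
  have h2 : a^-1 * sqn (xi t - y) <= e.
    by rewrite mulrC ler_pdivrMr//; lra.
  have := ler_norm (- dotv p (xi t - y)); rewrite normrN.
  have h3 : e * (1 + sqn (xi t - y)) <= e * 2 by rewrite ler_wpM2l ?(ltW e_gt0)//; lra.
  by have := sqn_ge0 (xi t - y); rewrite /e in h1 h2 h3 e12 *; lra.
have ymin z : v y <= v z by apply: le_trans (v_min z).
split; last exact: ymin.
apply: sqn_lt_cvg => e e0.
(* Because of the 1 in [Psi], the target is $1 + e$: at time [s] both factors are at most $1 + e_1$,
   and $(1+e_1)^2 \le 1 + 3e_1 < 1 + e$. *)
pose e1 := Num.min 1 (e / 4).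
have e10 : 0 < e1 by rewrite lt_min ltr01 divr_gt0.
have e11 : e1 <= 1 by rewrite ge_min lexx.
have e12 : e1 <= e / 4 by rewrite ge_min lexx orbT.
pose l := ln (1 + e1).
have l0 : 0 < l by rewrite ln_gt0// ltrDl.
(* By $e^{\lambda t} \ge \lambda t$, the exponent in [corr] is at most [l] from time [T] on. *)
pose T := 2 * K / lam / (l * lam).
have corrT t : 0 < t -> T <= t -> corr t <= 1 + e1.
  move=> t0 Tt; rewrite -[leRHS]lnK ?posrE ?addr_gt0//.
  rewrite /corr ler_expR -/l mulNr expRN ler_pdivrMr ?expR_gt0//.
  have : 2 * K / lam <= l * (lam * t).
    by move: Tt; rewrite /T ler_pdivrMr ?mulr_gt0//; lra.
  have := expR_ge1Dx (lam * t).
  move=> /(ler_wpM2l (ltW l0)); lra.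
have [s] := hy e1 (Num.truncn T).+1 e10.
move=> sn [hs _].
have s0 : 0 < s by apply: lt_le_trans sn.
have Ts : T <= s by apply: ltW; apply: lt_le_trans (truncnS_gt T) sn.
exists s => t st.
have cs := corrT s s0 Ts.
have := Psi_nincr ymin s0 st.
have := corr_ge1 t; have := sqn_ge0 (xi t - y); have := sqn_ge0 (xi s - y).
move=> q1 q2 q3.
have : Psi y s < (1 + e1) * (1 + e1).
  apply: (@lt_le_trans _ _ ((1 + e1) * corr s)).
    by rewrite ltr_pM2r ?ltrD2l// (lt_le_trans ltr01).
  by rewrite ler_wpM2l// ltW// addr_gt0.
have : 1 + sqn (xi t - y) <= Psi y t.
  by rewrite /Psi ler_peMr// addr_ge0.
nra.
Qed.

End perturbed_convex_flow.

(** * Moments and independence of Brownian increments *)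

Section normal_moments.
Context {R : realType}.
Local Notation mu := (@lebesgue_measure R).
Implicit Types (s x : R) (f : R -> R).

(** The Radon-Nikodym derivative agrees with the density almost everywhere, as both have the same
    integral over every measurable set. *)
Lemma ge0_integral_normal_prob s f : measurable_fun setT f ->
  (forall x, 0 <= f x) ->
  (\int[normal_prob 0 s]_x (f x)%:E = \int[mu]_x (f x * normal_pdf 0 s x)%:E)%E.
Proof.
move=> mf f0; have dom := @normal_prob_dominates R 0 s.
have h := Radon_Nikodym_SigmaFinite.change_of_variables dom
  (f := fun x => (f x)%:E) (E := setT).
rewrite -h//; last exact/measurable_EFinP.
apply: ae_eq_integral => //.
- apply: emeasurable_funM; first exact/measurable_EFinP.
  exact: measurable_int (Radon_Nikodym_SigmaFinite.f_integrable dom).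
- by apply/measurable_EFinP/measurable_funM => //; exact: measurable_normal_pdf.
- under [X in ae_eq _ _ _ X]eq_fun do rewrite EFinM.
  apply: ae_eqe_mul2l => /=; apply: integral_ae_eq => //.
  + exact: Radon_Nikodym_SigmaFinite.f_integrable.
  + by apply/measurable_EFinP; exact: measurable_normal_pdf.
  + by move=> E _ mE; rewrite -Radon_Nikodym_SigmaFinite.f_integral.
Qed.

Lemma normal_pdf0E s x : 0 < s ->
  normal_pdf 0 s x = normal_peak s * expR (- (x ^+ 2 / (s ^+ 2 *+ 2))).
Proof.
by move=> s0; rewrite normal_pdfE ?gt_eqF// /normal_fun subr0 mulNr.
Qed.

Lemma normal_peakZ c s : 0 < c -> normal_peak (c * s) = c^-1 * normal_peak s.
Proof.
move=> c0; rewrite /normal_peak.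
have -> : (c * s) ^+ 2 * pi *+ 2 = c ^+ 2 * (s ^+ 2 * pi *+ 2) by ring.
by rewrite sqrtrM ?sqr_ge0// sqrtr_sqr (gtr0_norm c0) invfM.
Qed.

(** Stands for the vanishing of the first moment, in a form for nonnegative integrands, where no
    integrability is at stake. *)
Lemma normal_prob_sym s f : 0 < s -> measurable_fun setT f ->
  (forall x, 0 <= f x) ->
  (\int[normal_prob 0 s]_x (f (- x))%:E = \int[normal_prob 0 s]_x (f x)%:E)%E.
Proof.
move=> s0 mf f0; have mN : measurable_fun setT (-%R : R -> R) by exact: oppr_measurable.
rewrite !ge0_integral_normal_prob//; last exact: measurableT_comp.
pose g x := (f x * normal_pdf 0 s x)%:E.
have mg : measurable_fun setT g.
  by apply/measurable_EFinP/measurable_funM => //; exact: measurable_normal_pdf.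
pose opp : measurableTypeR R -> measurableTypeR R := -%R.
have mopp : measurable_fun [set: measurableTypeR R] opp by exact: mN.
have pfE : (\int[pushforward mu opp]_x g x = \int[mu]_x (g \o opp) x)%E.
  have := @ge0_integral_pushforward _ _ _ _ R opp mopp mu setT g.
  rewrite preimage_setT; apply => // x _.
  by rewrite lee_fin mulr_ge0// normal_pdf_ge0.
transitivity (\int[pushforward mu opp]_x g x)%E.
  rewrite pfE.
  by apply: eq_integral => x _; rewrite /g/= !normal_pdf0E// sqrrN.
by apply: eq_measure_integral => A mA _; exact: lebesgue_measureN.
Qed.

(* The moments are only needed up to constants, and these come from comparing
   the density with those of standard deviation 2 s and s / 2. *)
Lemma normal_pdf_moment4 s x : 0 < s ->
  x ^+ 4 * normal_pdf 0 s x <= 57 * s ^+ 4 * normal_pdf 0 (2 * s) x.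
Proof.
move=> s0; rewrite !normal_pdf0E ?mulr_gt0// normal_peakZ//.
pose w := x ^+ 2 / (s ^+ 2 *+ 2).
have ss0 : s ^+ 2 *+ 2 != 0 by rewrite mulrn_eq0 expf_eq0/= gt_eqF.
have wE : x ^+ 4 = 4 * s ^+ 4 * w ^+ 2.
  by rewrite /w; field; rewrite gt_eqF.
have w2 : x ^+ 2 / ((2 * s) ^+ 2 *+ 2) = w / 4.
  by rewrite /w; field; rewrite gt_eqF.
have w0 : 0 <= w by rewrite divr_ge0 ?sqr_ge0// mulrn_wge0// sqr_ge0.
rewrite w2 -/w wE.
have -> : - w = - (w / 4) + - (3 * w / 4) by field.
rewrite expRD.
set E := expR (- (w / 4)); set F := expR (- (3 * w / 4)).
(* $e^{3w/4}$ is the square of $G \ge 3w/8$, whence $(8/3)^2 = 256/36$; four times this is below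
   $57/2$. *)
have : w ^+ 2 * F <= 256 / 36.
  rewrite /F expRN ler_pdivrMr ?expR_gt0//.
  have -> : 3 * w / 4 = 3 * w / 8 + 3 * w / 8 by field.
  rewrite expRD; have := expR_ge1Dx (3 * w / 8); set G := expR _ => hG.
  nra.
move=> h.
have E0 : 0 <= E by exact: expR_ge0.
have p0 := normal_peak_ge0 s.
have s4 : 0 <= s ^+ 4 by rewrite exprn_ge0// ltW.
have := mulr_ge0 (mulr_ge0 s4 p0) E0.
set A := s ^+ 4 * normal_peak s * E => A0.
have -> : 4 * s ^+ 4 * w ^+ 2 * (normal_peak s * (E * F)) = A * (4 * (w ^+ 2 * F)).
  by rewrite /A; ring.
have -> : 57 * s ^+ 4 * (2^-1 * normal_peak s * E) = A * (57 / 2) by rewrite /A; field.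
by rewrite ler_wpM2l//; lra.
Qed.

(** With $w = x^2/(2s^2)$ this is $1 \le e^{-3w} + 3w$. Integrated, it reads $1 \le 1/2 + 3M/(2s^2)$
    for the second moment $M$, that is $M \ge s^2/3$. *)
Lemma normal_pdf_moment2 s x : 0 < s ->
  normal_pdf 0 s x <= 2^-1 * normal_pdf 0 (2^-1 * s) x +
    3 / (2 * s ^+ 2) * (x ^+ 2 * normal_pdf 0 s x).
Proof.
move=> s0; rewrite !normal_pdf0E ?mulr_gt0// normal_peakZ// invrK.
pose w := x ^+ 2 / (s ^+ 2 *+ 2).
have wE : x ^+ 2 = 2 * s ^+ 2 * w by rewrite /w; field; rewrite gt_eqF.
have w2 : x ^+ 2 / ((2^-1 * s) ^+ 2 *+ 2) = w + 3 * w.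
  by rewrite /w; field; rewrite gt_eqF.
rewrite w2 -/w opprD expRD wE.
have := expR_ge1Dx (- (3 * w)).
set E := expR (- w); set F := expR (- (3 * w)) => h.
have p0 : 0 <= normal_peak s * E by rewrite mulr_ge0 ?normal_peak_ge0 ?expR_ge0.
have -> : 2^-1 * (2 * normal_peak s * (E * F)) = normal_peak s * E * F by field.
have -> : 3 / (2 * s ^+ 2) * (2 * s ^+ 2 * w * (normal_peak s * E)) =
   normal_peak s * E * (3 * w) by field; rewrite gt_eqF.
rewrite -mulrDr ler_peMr//; lra.
Qed.

Lemma normal_prob_moment4 s : 0 < s ->
  (\int[normal_prob 0 s]_x (x ^+ 4)%:E <= (57 * s ^+ 4)%:E)%E.
Proof.
move=> s0; rewrite ge0_integral_normal_prob//; last 1 first.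
  by move=> x; rewrite exprn_even_ge0.
have p0 (r x : R) : 0 <= normal_pdf 0 r x by exact: normal_pdf_ge0.
apply: (@le_trans _ _ (\int[mu]_x ((57 * s ^+ 4)%:E * (normal_pdf 0 (2 * s) x)%:E))%E).
  apply: ge0_le_integral => //.
  - by move=> x _; rewrite lee_fin mulr_ge0// exprn_even_ge0.
  - by apply/measurable_EFinP/measurable_funM => //; exact: measurable_normal_pdf.
  - by apply/measurable_EFinP/measurable_funM => //; exact: measurable_normal_pdf.
  - by move=> x _; rewrite -EFinM lee_fin normal_pdf_moment4.
rewrite ge0_integralZl//.
- by rewrite integral_normal_pdf mule1.
- by apply/measurable_EFinP; exact: measurable_normal_pdf.
- by move=> x _; rewrite lee_fin.
- by rewrite lee_fin mulr_ge0// exprn_ge0// ltW.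
Qed.

Lemma normal_prob_moment2 s : 0 < s ->
  ((s ^+ 2 / 3)%:E <= \int[normal_prob 0 s]_x (x ^+ 2)%:E)%E.
Proof.
move=> s0; rewrite ge0_integral_normal_prob//; last 1 first.
  by move=> x; rewrite sqr_ge0.
have p0 (r x : R) : 0 <= normal_pdf 0 r x by exact: normal_pdf_ge0.
have mp (r : R) : measurable_fun setT (normal_pdf 0 r) by exact: measurable_normal_pdf.
have c0 : 0 <= 3 / (2 * s ^+ 2) by rewrite divr_ge0// mulr_ge0// sqr_ge0.
have m1 : measurable_fun [set: R] (fun x : R => (2^-1 * normal_pdf 0 (2^-1 * s) x)%:E).
  by apply/measurable_EFinP/measurable_funM.
have m2 : measurable_fun [set: R] (fun x : R => (x ^+ 2 * normal_pdf 0 s x)%:E).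
  by apply/measurable_EFinP/measurable_funM.
have m3 : measurable_fun [set: R] (fun x : R => (3 / (2 * s ^+ 2) * (x ^+ 2 * normal_pdf 0 s x))%:E).
  by apply/measurable_EFinP/measurable_funM => //; apply/measurable_funM.
have : (1 <= (2^-1)%:E + (3 / (2 * s ^+ 2))%:E *
   \int[mu]_x (x ^+ 2 * normal_pdf 0 s x)%:E)%E.
  rewrite -[leLHS](integral_normal_pdf 0 s).
  apply: (@le_trans _ _ (\int[mu]_x ((2^-1 * normal_pdf 0 (2^-1 * s) x)%:E +
    (3 / (2 * s ^+ 2) * (x ^+ 2 * normal_pdf 0 s x))%:E))%E).
    apply: ge0_le_integral => //.
    - by move=> x _; rewrite lee_fin.
    - by apply/measurable_EFinP; exact: mp.
    - exact: emeasurable_funD.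
    - by move=> x _; rewrite -EFinD lee_fin normal_pdf_moment2.
  rewrite ge0_integralD//; last 2 first.
    by move=> x _; rewrite lee_fin mulr_ge0.
    by move=> x _; rewrite lee_fin mulr_ge0// mulr_ge0// sqr_ge0.
  under eq_integral do rewrite EFinM.
  rewrite ge0_integralZl//; last 2 first.
    by apply/measurable_EFinP; exact: mp.
    by move=> x _; rewrite lee_fin.
  rewrite integral_normal_pdf mule1 leeD2l//.
  under eq_integral do rewrite EFinM.
  by rewrite ge0_integralZl// => x _; rewrite lee_fin mulr_ge0// sqr_ge0.
set M := (\int[mu]_x _)%E.
case: M => [M||]; rewrite ?leey//; last first.
  by rewrite gt0_muleNy ?lte_fin ?divr_gt0 ?mulr_gt0 ?exprn_gt0.
rewrite -EFinM -EFinD !lee_fin => h.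
have : 2 * s ^+ 2 / 3 * 1 <= 2 * s ^+ 2 / 3 * (2^-1 + 3 / (2 * s ^+ 2) * M).
  by rewrite ler_wpM2l// divr_ge0// mulr_ge0// sqr_ge0.
have -> : 2 * s ^+ 2 / 3 * (2^-1 + 3 / (2 * s ^+ 2) * M) = s ^+ 2 / 3 + M.
  by field; rewrite gt_eqF.
lra.
Qed.

End normal_moments.

(** * Integrable and square-integrable real random variables *)

Section expectation_toolkit.
Context {R : realType} {disp : measure_display} {T : measurableType disp}
  (P : probability T R).
Implicit Types (f g h : T -> R) (c : R).

Definition L1 f := P.-integrable [set: T] (EFin \o f).
Definition L2 f := measurable_fun [set: T] f /\ L1 (fun w => f w ^+ 2).
Definition Ex f : R := \int[P]_w f w.

Lemma L1_measurable f : L1 f -> measurable_fun [set: T] f.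
Proof. by move=> /measurable_int /measurable_EFinP. Qed.

Lemma L1_le f g : measurable_fun [set: T] f -> (forall w, `|f w| <= g w) ->
  L1 g -> L1 f.
Proof.
move=> mf fg; apply: le_integrable => //; first exact/measurable_EFinP.
by move=> w _ /=; rewrite lee_fin (le_trans (fg w))// ler_norm.
Qed.

Lemma L1_cst c : L1 (fun=> c).
Proof. exact: finite_measure_integrable_cst. Qed.

Lemma L1D f g : L1 f -> L1 g -> L1 (fun w => f w + g w).
Proof. by move=> lf lg; have := integrableD measurableT lf lg. Qed.

Lemma L1Z c f : L1 f -> L1 (fun w => c * f w).
Proof. by move=> lf; have := integrableZl measurableT c lf. Qed.

Lemma L1B f g : L1 f -> L1 g -> L1 (fun w => f w - g w).
Proof. by move=> lf lg; have := integrableB measurableT lf lg. Qed.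

Lemma L1_sum (I : finType) (F : I -> T -> R) :
  (forall i, L1 (F i)) -> L1 (fun w => \sum_i F i w).
Proof.
move=> LF.
suff: forall s : seq I, L1 (fun w => \sum_(i <- s) F i w) by exact.
elim=> [|i s ih]; first by under eq_fun do rewrite big_nil; exact: L1_cst.
by under eq_fun do rewrite big_cons; exact: L1D.
Qed.

Lemma ExE f : L1 f -> (\int[P]_w (f w)%:E = (Ex f)%:E)%E.
Proof. by move=> lf; rewrite /Ex /Rintegral fineK//; exact: integrable_fin_num. Qed.

Lemma Ex_cst c : Ex (fun=> c) = c.
Proof.
rewrite /Ex /Rintegral integral_cst//= probability_setT.
by rewrite -[1%E]/(1%:E) -EFinM mulr1.
Qed.

Lemma ExD f g : L1 f -> L1 g -> Ex (fun w => f w + g w) = Ex f + Ex g.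
Proof. by move=> lf lg; exact: RintegralD. Qed.

Lemma ExB f g : L1 f -> L1 g -> Ex (fun w => f w - g w) = Ex f - Ex g.
Proof. by move=> lf lg; exact: RintegralB. Qed.

Lemma ExZ c f : L1 f -> Ex (fun w => c * f w) = c * Ex f.
Proof. by move=> lf; exact: RintegralZl. Qed.

Lemma Ex_sum (I : finType) (F : I -> T -> R) : (forall i, L1 (F i)) ->
  Ex (fun w => \sum_i F i w) = \sum_i Ex (F i).
Proof.
move=> LF; have := integral_sum measurableT (I := I) (f := fun i => EFin \o F i) LF.
move=> /(_ (index_enum I) xpredT) h.
apply: EFin_inj; rewrite -ExE; last exact: L1_sum.
rewrite -sumEFin; under [RHS]eq_bigr do rewrite -ExE//.
by rewrite -h; apply: eq_integral => w _; rewrite sumEFin.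
Qed.

Lemma Ex_le f g : L1 f -> L1 g -> (forall w, f w <= g w) -> Ex f <= Ex g.
Proof. by move=> lf lg fg; apply: le_Rintegral. Qed.

Lemma Ex_ge0 f : (forall w, 0 <= f w) -> 0 <= Ex f.
Proof. by move=> f0; exact: Rintegral_ge0. Qed.

Lemma L2_cst c : L2 (fun=> c).
Proof. by split; [exact: measurable_cst|exact: L1_cst]. Qed.

Lemma L2_L1 f : L2 f -> L1 f.
Proof.
move=> [mf lf]; apply: L1_le mf _ (L1D (L1_cst 1) lf) => w.
have := sqr_ge0 (`|f w| - 1); have := real_normK (num_real (f w)).
have := normr_ge0 (f w); nra.
Qed.

Lemma L2_le f g : measurable_fun [set: T] f -> (forall w, `|f w| <= g w) ->
  L2 g -> L2 f.
Proof.
move=> mf fg [_ lg]; split => //.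
apply: L1_le lg; first exact: measurable_funX.
move=> w; rewrite normrX ler_pXn2r ?nnegrE// (le_trans _ (fg w))//.
Qed.

Lemma L2D f g : L2 f -> L2 g -> L2 (fun w => f w + g w).
Proof.
move=> [mf lf] [mg lg]; split; first exact: measurable_funD.
apply: L1_le (L1Z 2 (L1D lf lg)) => [|w].
  by apply: measurable_funX; exact: measurable_funD.
rewrite ger0_norm ?sqr_ge0//; have := sqr_ge0 (f w - g w); nra.
Qed.

Lemma L2Z c f : L2 f -> L2 (fun w => c * f w).
Proof.
move=> [mf lf]; split; first exact: measurable_funM.
under eq_fun do rewrite exprMn; exact: L1Z.
Qed.

Lemma L2_sum (I : finType) (F : I -> T -> R) :
  (forall i, L2 (F i)) -> L2 (fun w => \sum_i F i w).
Proof.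
move=> LF.
suff: forall s : seq I, L2 (fun w => \sum_(i <- s) F i w) by exact.
elim=> [|i s ih]; first by under eq_fun do rewrite big_nil; exact: L2_cst.
by under eq_fun do rewrite big_cons; exact: L2D.
Qed.

Lemma L2M f g : L2 f -> L2 g -> L1 (fun w => f w * g w).
Proof.
move=> [mf lf] [mg lg].
apply: L1_le (L1D lf lg) => [|w]; first exact: measurable_funM.
rewrite normrM.
have := sqr_ge0 (`|f w| - `|g w|).
have := real_normK (num_real (f w)); have := real_normK (num_real (g w)).
have := sqr_ge0 (f w); have := sqr_ge0 (g w); nra.
Qed.

Lemma L2_bounded f M : measurable_fun [set: T] f -> (forall w, `|f w| <= M) -> L2 f.
Proof. by move=> mf fM; apply: L2_le mf fM (L2_cst M). Qed.

Lemma L2Ml_bounded f g M : measurable_fun [set: T] f -> (forall w, `|f w| <= M) ->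
  L2 g -> L2 (fun w => f w * g w).
Proof.
move=> mf fM [mg lg]; split; first exact: measurable_funM.
apply: L1_le (L1Z (M ^+ 2) lg) => [|w].
  by apply: measurable_funX; exact: measurable_funM.
rewrite exprMn normrM !ger0_norm ?sqr_ge0// ler_wpM2r ?sqr_ge0//.
rewrite -(real_normK (num_real (f w))) ler_pXn2r ?nnegrE//.
by rewrite (le_trans _ (fM w)).
Qed.

Lemma L1Ml_bounded f g M : measurable_fun [set: T] f -> (forall w, `|f w| <= M) ->
  L1 g -> L1 (fun w => f w * g w).
Proof.
move=> mf fM lg; have mg := L1_measurable lg.
have lag : L1 (fun w => `|g w|).
  by have := integrable_norm lg.
apply: L1_le (L1Z M lag) => [|w]; first exact: measurable_funM.
by rewrite normrM ler_wpM2r.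
Qed.

(** The integral of $|f| \le c + f^2/c$; it is applied with $E f^2 \le c^2$, giving $2c$. *)
Lemma Ex_sqr_small f : L2 f -> forall c, 0 < c ->
  `|Ex f| <= c + c^-1 * Ex (fun w => f w ^+ 2).
Proof.
move=> l2f c c0; have lf := L2_L1 l2f; have [mf lf2] := l2f.
have bnd w : `|f w| <= c + c^-1 * f w ^+ 2.
  have h : 0 <= (`|f w| - c) ^+ 2 by exact: sqr_ge0.
  rewrite -(ler_pM2l c0) mulrDr mulVKf ?gt_eqF//.
  have := real_normK (num_real (f w)); have := normr_ge0 (f w); nra.
have l1 : L1 (fun w => c + c^-1 * f w ^+ 2) by apply: L1D (L1_cst c) (L1Z _ lf2).
have -> : c + c^-1 * Ex (fun w => f w ^+ 2) = Ex (fun w => c + c^-1 * f w ^+ 2).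
  by rewrite ExD ?ExZ ?Ex_cst//; [exact: L1_cst|exact: L1Z].
rewrite ler_norml; apply/andP; split.
  rewrite -lerN2 opprK -mulN1r -ExZ//; apply: Ex_le => //; first exact: L1Z.
  move=> w; rewrite mulN1r; apply: le_trans (bnd w).
  by rewrite -normrN ler_norm.
by apply: Ex_le => // w; apply: le_trans (bnd w); rewrite ler_norm.
Qed.

End expectation_toolkit.

(** * Independence from a sub-sigma-algebra as a product law *)

Section independence.
Context {R : realType} {disp : measure_display} {T : measurableType disp}
  (P : probability T R).
Variables (G : set (set T)) (Y : T -> R) (N : probability (measurableTypeR R) R).
Local Notation TG := (g_sigma_algebraType G).
Hypothesis G_measurable : <<s G >> `<=` @measurable _ T.
Hypothesis mY : measurable_fun [set: T] Y.
Hypothesis GY_indep : forall (B : set T) (A : set R), <<s G >> B ->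
  measurable A -> P (B `&` Y @^-1` A) = (P B * N A)%E.

(** The identity from [T] to [T] with the coarser sigma-algebra is a random variable, and
    independence says that its joint law with [Y] is a product on rectangles. Uniqueness of product
    measures reduces the claim to Tonelli. *)
Lemma indep_tonelli (Z : T -> R) (phi : R -> R) :
  measurable_fun [set: TG] (Z : TG -> R) -> measurable_fun [set: R] phi ->
  (forall w, 0 <= Z w) -> (forall y, 0 <= phi y) ->
  (\int[P]_w (Z w * phi (Y w))%:E =
   (\int[P]_w (Z w)%:E) * \int[N]_y (phi y)%:E)%E.
Proof.
move=> mZ mphi Z0 phi0.
have mid : measurable_fun [set: T] (id : T -> TG).
  by move=> _ B mB; rewrite setTI; exact: G_measurable.
pose idm := isMeasurableFun.Build _ _ _ _ _ mid.
pose idG : {mfun T >-> TG} := HB.pack (id : T -> TG) idm.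
pose pr (w : T) : TG * measurableTypeR R := (w, Y w).
have mpr : measurable_fun [set: T] pr.
  exact: (measurable_fun_pair mid mY).
pose prm := isMeasurableFun.Build _ _ _ _ _ mpr.
pose prG : {mfun T >-> (TG * measurableTypeR R)%type} := HB.pack pr prm.
have prodE := @product_measure_unique _ _ TG (measurableTypeR R) R
  (distribution P idG) N (distribution P prG).
pose f (z : TG * measurableTypeR R) := (Z z.1 * phi z.2)%:E.
have mf : measurable_fun setT f.
  apply/measurable_EFinP; apply: measurable_funM.
    exact: measurableT_comp mZ (@measurable_fst _ _ _ _).
  exact: measurableT_comp mphi (@measurable_snd _ _ _ _).
have f0 z : (0 <= f z)%E by rewrite lee_fin mulr_ge0.
transitivity (\int[distribution P prG]_z f z)%E.
  by rewrite ge0_integral_distribution.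
transitivity (\int[distribution P idG \x N]_z f z)%E.
  have {}prodE := prodE (fun B C mB mC => GY_indep mB mC).
  apply: eq_measure_integral => A mA _.
  by first [exact: prodE|exact/esym/prodE].
rewrite fubini_tonelli1//.
rewrite /fubini_F /f/=.
have mphi' : measurable_fun [set: measurableTypeR R] (EFin \o phi).
  exact/measurable_EFinP.
transitivity (\int[distribution P idG]_x ((\int[N]_y (phi y)%:E) * (Z x)%:E))%E.
  apply: eq_integral => x _.
  under eq_integral do rewrite EFinM.
  rewrite muleC; apply: ge0_integralZl => //; last by rewrite lee_fin.
  by move=> y _; rewrite lee_fin.
rewrite ge0_integralZl//.
- rewrite muleC; congr (_ * _)%E.
  by rewrite ge0_integral_distribution//; exact/measurable_EFinP.
- exact/measurable_EFinP.
- by move=> x _; rewrite lee_fin.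
- by apply: integral_ge0 => y _; rewrite lee_fin.
Qed.

End independence.

(** * Brownian increments tested against the past *)

Section brownian_increments.
Context {R : realType} {d : nat} {disp : measure_display}
  {T : measurableType disp} (P : probability T R) (W : R -> T -> 'rV[R]_d).
Hypothesis bW : is_brownian P W.
Implicit Types (s t : R) (i : 'I_d) (f : T -> R).

Definition adapted s f :=
  measurable_fun [set: g_sigma_algebraType (history W s)] f.

Lemma history_measurable s : <<s history W s >> `<=` @measurable _ T.
Proof.
apply: smallest_sub; first exact: sigma_algebra_measurable.
move=> _ [r [i [B [/andP[r0 _] mB ->]]]].
by have := brownian_measurable bW i r0 measurableT mB; rewrite setTI.
Qed.

Lemma history_le s t : s <= t -> <<s history W s >> `<=` <<s history W t >>.
Proof.
move=> st; apply: sub_smallest2r; first exact: smallest_sigma_algebra.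
move=> A [r [i [B [/andP[r0 rs] mB ->]]]].
by exists r, i, B; split => //; rewrite r0 (le_trans rs).
Qed.

Lemma adapted_measurable s f : adapted s f -> measurable_fun [set: T] f.
Proof.
by move=> mf _ B mB; apply: (@history_measurable s); exact: (mf measurableT B mB).
Qed.

Lemma adapted_le s t f : s <= t -> adapted s f -> adapted t f.
Proof.
by move=> st mf _ B mB; apply: (history_le st); exact: (mf measurableT B mB).
Qed.

Lemma adapted_brownian s r i : 0 <= r -> r <= s ->
  adapted s (fun w => W r w 0 i).
Proof.
move=> r0 rs _ B mB; rewrite setTI; apply: sub_gen_smallest.
by exists r, i, B; split => //; rewrite r0.
Qed.

Definition incr s t i (w : T) : R := W t w 0 i - W s w 0 i.

Lemma incr_indep s t i (B : set T) (A : set R) : 0 <= s -> s < t ->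
  <<s history W s >> B -> measurable A ->
  P (B `&` incr s t i @^-1` A) =
    (P B * normal_prob 0 (Num.sqrt (t - s)) A)%E.
Proof.
move=> s0 st hB mA.
have := @brownian_increments _ _ _ _ _ _ bW s t s0 st B
  (fun j => if j == i then A else setT) hB.
have -> : [set w | forall j : 'I_d, (if j == i then A else setT)
    (W t w 0 j - W s w 0 j)] = incr s t i @^-1` A.
  apply/seteqP; split => [w /(_ i)|w /= h j]; first by rewrite eqxx.
  by case: eqVneq => // ->.
move=> -> => [|j]; last by case: ifP.
congr (_ * _)%E; rewrite (bigD1 i)//= eqxx big1 ?mule1// => j /negbTE ->.
exact: probability_setT.
Qed.

Lemma measurable_incr s t i : 0 <= s -> s <= t ->
  measurable_fun [set: T] (incr s t i).
Proof.
move=> s0 st; apply: measurable_funB; apply: (brownian_measurable bW) => //.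
exact: le_trans st.
Qed.

Lemma incr_tonelli s t i (Z : T -> R) (phi : R -> R) : 0 <= s -> s < t ->
  adapted s Z -> measurable_fun [set: R] phi ->
  (forall w, 0 <= Z w) -> (forall y, 0 <= phi y) ->
  (\int[P]_w (Z w * phi (incr s t i w))%:E =
   (\int[P]_w (Z w)%:E) * \int[normal_prob 0 (Num.sqrt (t - s))]_y (phi y)%:E)%E.
Proof.
move=> s0 st aZ mphi Z0 phi0; apply: (@indep_tonelli _ _ _ _ (history W s)) => //.
- exact: history_measurable.
- exact: measurable_incr (ltW st).
- by move=> B A hB mA; exact: incr_indep.
Qed.


Lemma incr_moment4 s t i : 0 <= s -> s < t ->
  L1 P (fun w => incr s t i w ^+ 4) /\
  Ex P (fun w => incr s t i w ^+ 4) <= 57 * (t - s) ^+ 2.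
Proof.
move=> s0 st; have mI := measurable_incr i s0 (ltW st).
have ts : 0 < t - s by rewrite subr_gt0.
have ev4 (x : R) : 0 <= x ^+ 4 by rewrite exprn_even_ge0.
have bnd : (\int[P]_w (incr s t i w ^+ 4)%:E <= (57 * (t - s) ^+ 2)%:E)%E.
  have := @incr_tonelli s t i (fun=> 1) (fun x => x ^+ 4) s0 st.
  rewrite integral_cst//= probability_setT mule1 mul1e.
  under eq_integral do rewrite mul1r.
  move=> -> //.
  - apply: (le_trans (normal_prob_moment4 _)); first by rewrite sqrtr_gt0.
    by rewrite -[4%N]/(2 * 2)%N exprM sqr_sqrtr// ltW.
  - exact: measurable_cst.
have l1 : L1 P (fun w => incr s t i w ^+ 4).
  apply/integrableP; split; first by apply/measurable_EFinP; exact: measurable_funX.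
  apply: le_lt_trans (ltry (57 * (t - s) ^+ 2)); apply: le_trans bnd.
  by under eq_integral do rewrite /= ger0_norm//.
by split => //; rewrite -lee_fin -ExE.
Qed.

Lemma incr_L2 s t i : 0 <= s -> s <= t -> L2 P (incr s t i).
Proof.
move=> s0; rewrite le_eqVlt => /predU1P[<-|st].
  have -> : incr s s i = (fun=> 0) by apply/funext => w; rewrite /incr subrr.
  exact: L2_cst.
have mI := measurable_incr i s0 (ltW st); split => //.
apply: (@L1_le _ _ _ P _ (fun w => 1 + incr s t i w ^+ 4)).
- exact: measurable_funX.
- move=> w; rewrite ger0_norm ?sqr_ge0//.
  by have := sqr_ge0 (incr s t i w ^+ 2 - 1); nra.
- by apply: L1D; [exact: L1_cst|have [] := incr_moment4 i s0 st].
Qed.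

Lemma incr_mul_eq0 s t i (Z : T -> R) M : 0 <= s -> s <= t ->
  adapted s Z -> (forall w, `|Z w| <= M) ->
  Ex P (fun w => Z w * incr s t i w) = 0.
Proof.
move=> s0; rewrite le_eqVlt => /predU1P[<-|st] aZ ZM.
  rewrite -[RHS](Ex_cst P 0); congr (Ex P _).
  by apply/funext => w; rewrite /incr subrr mulr0.
have mI := measurable_incr i s0 (ltW st).
have lI := incr_L2 i s0 (ltW st).
(* E[Z Y^+] = E[Z Y^-] for Z >= 0, by symmetry of the normal law *)
have pos (V : T -> R) K : adapted s V -> (forall w, 0 <= V w <= K) ->
    Ex P (fun w => V w * incr s t i w) = 0.
  move=> aV V0K.
  have V0 w : 0 <= V w by have /andP[] := V0K w.
  have mV := adapted_measurable aV.
  have VK w : `|V w| <= K by rewrite ger0_norm//; have /andP[] := V0K w.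
  pose pp x : R := Num.max x 0.
  have pp0 x : 0 <= pp x by rewrite le_max lexx orbT.
  have mpp : measurable_fun [set: R] pp by exact: measurable_maxr.
  have ppN x : pp x - pp (- x) = x.
    rewrite /pp; case: (lerP x 0) => x0.
      by rewrite max_l ?oppr_ge0// sub0r opprK.
    by rewrite max_r ?subr0// oppr_le0 ltW.
  have ppL x : `|pp x| <= `|x|.
    by rewrite ger0_norm// /pp ge_max normr_ge0 ler_norm.
  have l (F : R -> R) : measurable_fun [set: R] F -> (forall x, `|F x| <= `|x|) ->
      L1 P (fun w => V w * F (incr s t i w)).
    move=> mF FL; have mFI : measurable_fun [set: T] (fun w => F (incr s t i w)).
      exact: measurableT_comp mF mI.
    apply: (L1Ml_bounded mV VK).
    apply: (L1_le mFI) (integrable_norm (L2_L1 lI)) => w.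
    exact: FL.
  have mppN : measurable_fun [set: R] (fun x => pp (- x)).
    exact: measurableT_comp mpp (@oppr_measurable _ _).
  have l1 := l _ mpp ppL.
  have l2 : L1 P (fun w => V w * pp (- incr s t i w)).
    by apply: (l (fun x => pp (- x))) => // x; rewrite -(normrN x).
  have -> : (fun w => V w * incr s t i w) =
     (fun w => V w * pp (incr s t i w) - V w * pp (- incr s t i w)).
    by apply/funext => w; rewrite -mulrBr ppN.
  rewrite ExB//; apply/eqP; rewrite subr_eq0; apply/eqP; apply: EFin_inj.
  rewrite -!ExE// (@incr_tonelli s t i V pp)//.
  rewrite (@incr_tonelli s t i V (fun x => pp (- x)))//.
  by rewrite normal_prob_sym// sqrtr_gt0 subr_gt0.
have mZ := adapted_measurable aZ.
(* Shifting by [M] makes the bounded [Z] nonnegative, as [pos] requires. *)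
have aZM : adapted s (fun w => Z w + M).
  exact: (measurable_funD aZ (measurable_cst _)).
have aM : adapted s (fun=> `|M|) by exact: measurable_cst.
have l1 : L1 P (fun w => (Z w + M) * incr s t i w).
  apply: (@L1Ml_bounded _ _ _ P _ _ (2 * M)).
  - exact: measurable_funD.
  - by move=> w; have := ZM w; rewrite ler_norml ler_norml; lra.
  - exact: L2_L1.
have l2 : L1 P (fun w => M * incr s t i w) by exact: L1Z (L2_L1 lI).
have -> : (fun w => Z w * incr s t i w) =
    (fun w => (Z w + M) * incr s t i w - M * incr s t i w).
  by apply/funext => w; ring.
rewrite ExB//.
rewrite (pos _ (2 * M) aZM); last by move=> w; have := ZM w; rewrite ler_norml; lra.
rewrite ExZ; last exact: L2_L1.
have : Ex P (fun w => 1 * incr s t i w) = 0.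
  by apply: (pos (fun=> 1) 1) => [|w]; [exact: measurable_cst|rewrite ler01 lexx].
under eq_fun do rewrite mul1r.
by move=> ->; rewrite mulr0 subrr.
Qed.

(** Variance decay only calls for a lower bound; the 1/3 of [normal_prob_moment2] merely slows the
    rate. *)
Lemma incr_sqr_ge s t i (Z : T -> R) M : 0 <= s -> s <= t ->
  adapted s Z -> (forall w, 0 <= Z w <= M) ->
  (t - s) / 3 * Ex P Z <= Ex P (fun w => Z w * incr s t i w ^+ 2).
Proof.
move=> s0; rewrite le_eqVlt => /predU1P[<-|st] aZ Z0M.
  by rewrite subrr !mul0r; apply: Ex_ge0 => w; rewrite /incr subrr expr0n mulr0.
have Z0 w : 0 <= Z w by have /andP[] := Z0M w.
have mZ := adapted_measurable aZ.
have ZM w : `|Z w| <= M by rewrite ger0_norm//; have /andP[] := Z0M w.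
have lZ : L1 P Z by apply: L2_L1; exact: L2_bounded ZM.
have [mI lI] := incr_L2 i s0 (ltW st).
have l1 : L1 P (fun w => Z w * incr s t i w ^+ 2) by exact: L1Ml_bounded ZM lI.
rewrite -lee_fin EFinM -!ExE//.
have -> : (\int[P]_w (Z w * incr s t i w ^+ 2)%:E = (\int[P]_w (Z w)%:E) *
    \int[normal_prob 0 (Num.sqrt (t - s))]_y (y ^+ 2)%:E)%E.
  apply: (@incr_tonelli s t i Z (fun x => x ^+ 2)) => //.
  by move=> y; rewrite sqr_ge0.
rewrite muleC; apply: lee_wpmul2l.
  by apply: integral_ge0 => w _; rewrite lee_fin.
have ts : 0 < t - s by rewrite subr_gt0.
apply: le_trans (normal_prob_moment2 _); last by rewrite sqrtr_gt0.
by rewrite sqr_sqrtr// ltW.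
Qed.

End brownian_increments.

(** * Elementary controls and the value function *)

Section coordinatewise_measurability.
Context {R : realType} {d : nat} {disp : measure_display} {T : measurableType disp}.

(** An open set is the union of the rational boxes it contains. There are countably many, enumerated
    by [unpickle], and the preimage of a box is a finite intersection of coordinate events. *)
Lemma measurable_preimage_open (X : T -> 'rV[R]_d) (U : set 'rV[R]_d) :
  (forall i, measurable_fun [set: T] (fun w => X w 0 i)) -> open U ->
  measurable (X @^-1` U).
Proof.
move=> mX oU.
pose box (c : {ffun 'I_d -> rat * rat}) : set 'rV[R]_d :=
  [set x | forall i, ratr (c i).1 < x 0 i < ratr (c i).2].
pose A (n : nat) : set T := match unpickle n with
  | Some c => if `[< box c `<=` U >] then X @^-1` box c else set0
  | None => set0 end.
have -> : X @^-1` U = \bigcup_n A n.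
  apply/seteqP; split => w /=; last first.
    move=> [n _]; rewrite /A; case: unpickle => [c|//].
    by case: asboolP => // cU; exact: cU.
  move=> Uw; have /nbhs_ballP[e /= e0 eU] := open_nbhs_nbhs (conj oU Uw).
  have /fin_all_exists[a ha] (i : 'I_d) : exists q : rat,
      ratr q \in `](X w 0 i - e), (X w 0 i)[%R.
    by apply: rat_in_itvoo; rewrite gtrBl.
  have /fin_all_exists[b hb] (i : 'I_d) : exists q : rat,
      ratr q \in `](X w 0 i), (X w 0 i + e)[%R.
    by apply: rat_in_itvoo; rewrite ltrDl.
  pose c := [ffun i => (a i, b i)].
  have bc : box c (X w).
    move=> i; rewrite /c ffunE/=.
    by have := ha i; have := hb i; rewrite !in_itv/= => /andP[-> _] /andP[_ ->].
  have cU : box c `<=` U.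
    move=> x bx; apply: eU; split => // k i; rewrite ord1.
    rewrite /ball/= ltr_distlC.
    have := bx i; rewrite /c ffunE/= => /andP[h1 h2].
    have := ha i; have := hb i; rewrite !in_itv/= => /andP[_ h3] /andP[h4 _].
    by rewrite (lt_trans h4 h1) (lt_trans h2 h3).
  by exists (pickle c) => //; rewrite /A pickleK; case: asboolP.
apply: bigcup_measurable => n _; rewrite /A.
case: unpickle => [c|]; last exact: measurable0.
case: asboolP => _; last exact: measurable0.
have -> : X @^-1` box c = \big[setI/setT]_(i < d)
    ((fun w => X w 0 i) @^-1` `]ratr (c i).1, ratr (c i).2[).
  rewrite -bigcap_seq; apply/seteqP; split.
    by move=> w h i _ /=; rewrite in_itv/=; exact: h.
  by move=> w h i; have := h i (mem_index_enum i); rewrite /= in_itv.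
apply: bigsetI_measurable => i _.
by have := mX i measurableT `]ratr (c i).1, ratr (c i).2[%classic; rewrite setTI; apply.
Qed.

Lemma measurable_continuous_coord (f : 'rV[R]_d -> R) (X : T -> 'rV[R]_d) :
  continuous f -> (forall i, measurable_fun [set: T] (fun w => X w 0 i)) ->
  measurable_fun [set: T] (f \o X).
Proof.
move=> cf mX; apply: (measurability _ (RGenOInfty.measurableE R)).
move=> /= _ [_ [a ->] <-]; rewrite setTI comp_preimage.
apply: measurable_preimage_open => //.
apply: open_comp; first by move=> x _; exact: cf.
by rewrite set_itvE; exact: open_gt.
Qed.

End coordinatewise_measurability.

Section frobenius_norm.
Context {R : realType} {d : nat}.
Implicit Types (A : 'M[R]_d) (M : R).

Lemma mxfrob_sqr A : mxfrob A ^+ 2 = \sum_i \sum_j A i j ^+ 2.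
Proof.
have E : \tr (A *m A^T) = \sum_i \sum_j A i j ^+ 2.
  by apply: eq_bigr => i _; rewrite mxE; apply: eq_bigr => j _; rewrite mxE expr2.
rewrite sqr_sqrtr E//.
by do 2 (apply: sumr_ge0 => ? _); rewrite sqr_ge0.
Qed.

Lemma mxfrob_ge0 A : 0 <= mxfrob A.
Proof. exact: sqrtr_ge0. Qed.

Lemma mxfrob_le A M : 0 <= M ->
  (mxfrob A <= M) = (\sum_i \sum_j A i j ^+ 2 <= M ^+ 2).
Proof. by move=> M0; rewrite -mxfrob_sqr ler_pXn2r// nnegrE mxfrob_ge0. Qed.

Lemma mxfrob0 : mxfrob (0 : 'M[R]_d) = 0.
Proof. by rewrite /mxfrob mul0mx mxtrace0 sqrtr0. Qed.

Lemma mxfrobZ (a : R) A : mxfrob (a *: A) = `|a| * mxfrob A.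
Proof.
apply/eqP; rewrite -(@eqrXn2 _ 2)// ?mulr_ge0 ?mxfrob_ge0//.
rewrite exprMn !mxfrob_sqr real_normK ?num_real// big_distrr/=.
apply/eqP; apply: eq_bigr => i _; rewrite big_distrr/=.
by apply: eq_bigr => j _; rewrite mxE exprMn.
Qed.

Lemma coord_le_mxfrob A i j : `|A i j| <= mxfrob A.
Proof.
rewrite -(@ler_pXn2r _ 2)// ?nnegrE ?mxfrob_ge0// real_normK ?num_real// mxfrob_sqr.
rewrite (bigD1 i)//= (bigD1 j)//= -addrA lerDl addr_ge0//.
  by apply: sumr_ge0 => ? _; rewrite sqr_ge0.
by do 2 (apply: sumr_ge0 => ? _); rewrite sqr_ge0.
Qed.

End frobenius_norm.

(** * Ito integrals of elementary controls *)

Section elementary_integrals.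
Context {R : realType} {d : nat} {disp : measure_display}
  {T : measurableType disp} (P : probability T R) (W : R -> T -> 'rV[R]_d).
Hypothesis bW : is_brownian P W.
Implicit Types (t : R) (e : @elementary R d disp T).

Lemma el_time_homo e t : is_elementary W t e ->
  forall k l, (k <= l <= el_size e)%N -> el_time e k <= el_time e l.
Proof.
move=> [_ _ h _ _] k l /andP[kl le].
elim: l kl le => [|l ih]; first by rewrite leqn0 => /eqP ->.
rewrite leq_eqVlt => /predU1P[->//|]; rewrite ltnS => kl le.
by apply: (le_trans (ih kl (ltnW le))); exact: h.
Qed.

Lemma el_time_ge0 e t : is_elementary W t e ->
  forall k, (k <= el_size e)%N -> 0 <= el_time e k.
Proof.
move=> he k ke; have [<- _ _ _ _] := he.
by apply: (el_time_homo he); rewrite ke.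
Qed.

Lemma el_int_coord e w i : el_int W e w 0 i = \sum_(k < el_size e) \sum_j
  el_coef e k w i j * incr W (el_time e k) (el_time e k.+1) j w.
Proof.
rewrite /el_int summxE; apply: eq_bigr => k _; rewrite mxE.
by apply: eq_bigr => j _; rewrite !mxE mulrC.
Qed.

Lemma el_int_moments e t : is_elementary W t e -> forall i,
  L2 P (fun w => el_int W e w 0 i) /\ Ex P (fun w => el_int W e w 0 i) = 0.
Proof.
move=> he i; have [_ _ tmono acoef [M coefM]] := he.
have l2 (k : 'I_(el_size e)) j : L2 P (fun w => el_coef e k w i j *
    incr W (el_time e k) (el_time e k.+1) j w).
  apply: (@L2Ml_bounded _ _ _ P _ _ M).
  - exact: (adapted_measurable bW (acoef k i j (ltn_ord k))).
  - by move=> w; apply: le_trans (coord_le_mxfrob _ _ _) (coefM k w (ltn_ord k)).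
  - apply: (incr_L2 bW); last exact: tmono.
    by apply: (el_time_ge0 he); exact: ltnW.
have E : (fun w => el_int W e w 0 i) = (fun w => \sum_(k < el_size e) \sum_j
    el_coef e k w i j * incr W (el_time e k) (el_time e k.+1) j w).
  by apply/funext => w; exact: el_int_coord.
rewrite E; split; first by do 2 apply: L2_sum => ?.
rewrite Ex_sum => [|k]; last by apply: L2_L1; apply: L2_sum.
rewrite big1// => k _; rewrite Ex_sum => [|j]; last exact: L2_L1.
rewrite big1// => j _; apply: (@incr_mul_eq0 _ _ _ _ P W bW _ _ _ _ M) => //.
- by apply: (el_time_ge0 he); exact: ltnW.
- exact: tmono.
- exact: acoef.
- by move=> w; apply: le_trans (coord_le_mxfrob _ _ _) (coefM k w (ltn_ord k)).
Qed.

(** The half-open intervals are disjoint, so at most one summand is nonzero. *)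
Lemma el_val_mxfrob_le e t M : is_elementary W t e -> 0 <= M ->
  (forall k w, (k < el_size e)%N -> mxfrob (el_coef e k w) <= M) ->
  forall s w, mxfrob (el_val e s w) <= M.
Proof.
move=> he M0 coefM s w; rewrite /el_val.
have [/existsP[k ck]|] := boolP [exists k : 'I_(el_size e),
    el_time e k < s <= el_time e k.+1].
  rewrite (bigD1 k)//= ck big1 ?addr0//; first exact: coefM.
  move=> l lk; case: ifPn => // cl.
  move: lk ck cl; rewrite -val_eqE/= neq_ltn => /orP[lk|lk].
    have : el_time e l.+1 <= el_time e k.
      by apply: (el_time_homo he); rewrite lk ltnW.
    by move=> h1 /andP[h2 _] /andP[_ h3]; have := lt_le_trans h2 (le_trans h3 h1); rewrite ltxx.
  have : el_time e k.+1 <= el_time e l.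
    by apply: (el_time_homo he); rewrite lk ltnW.
  by move=> h1 /andP[_ h2] /andP[h3 _]; have := lt_le_trans h3 (le_trans h2 h1); rewrite ltxx.
rewrite negb_exists => /forallP h; rewrite big1 ?mxfrob0// => k _.
by rewrite (negbTE (h k)).
Qed.

Lemma el_val_progressive e t : is_elementary W t e ->
  progressively_measurable W (el_val e).
Proof.
move=> he tau tau0 i j; have [_ _ tmono acoef _] := he.
set D := (_ `*` _).
have mD : measurable D by apply: measurableX => //; exact: measurable_itv.
have -> : (fun p : R * g_sigma_algebraType (history W tau) => el_val e p.1 p.2 i j) =
    (fun p => \sum_(k < el_size e)
      (if el_time e k < p.1 <= el_time e k.+1 then el_coef e k p.2 i j else 0)).
  apply/funext => p; rewrite /el_val summxE; apply: eq_bigr => k _.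
  by case: ifP => // _; rewrite mxE.
apply: measurable_sum => k.
(* An interval starting after [tau] does not meet [[0, tau]], so its coefficient, possibly unknown
   at time [tau], does not enter. *)
have [ktau|tauk] := lerP (el_time e k) tau; last first.
  have c0 : measurable_fun D (fun=> 0 : R) by exact: measurable_cst.
  apply: eq_measurable_fun c0.
  move=> p; rewrite inE => -[/= + _]; rewrite in_itv/= => /andP[_ ptau].
  by rewrite ltNge (le_trans ptau (ltW tauk)).
have -> : (fun p : R * g_sigma_algebraType (history W tau) =>
     if el_time e k < p.1 <= el_time e k.+1 then el_coef e k p.2 i j else 0) =
    (fun p => \1_(`]el_time e k, el_time e k.+1]%classic : set R) p.1 *
      el_coef e k p.2 i j).
  apply/funext => p; rewrite indicE mem_setE in_itv/=.
  by case: ifP => _; rewrite ?mul1r ?mul0r.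
apply: measurable_funTS; apply: measurable_funM.
  apply: measurableT_comp; last exact: measurable_fst.
  exact: measurable_indic.
have := adapted_le ktau (acoef k i j (ltn_ord k)) => ak.
exact: (measurableT_comp ak (@measurable_snd _ _ _ _)).
Qed.

(** The constant sequence approximates the control with zero error. The bound $\sqrt 2$ on the
    coefficients becomes 1 once the factor $\sqrt 2$ of the problem is divided out. *)
Lemma elementary_control e t : is_elementary W t e ->
  (forall k w, (k < el_size e)%N -> mxfrob (el_coef e k w) <= Num.sqrt 2) ->
  exists sigma, admissible W sigma /\
    is_ito_integral P W (fun s w => Num.sqrt 2 *: sigma s w) t (el_int W e).
Proof.
move=> he coefM; have s20 : 0 < Num.sqrt 2 :> R by rewrite sqrtr_gt0.
exists (fun s w => (Num.sqrt 2)^-1 *: el_val e s w); split.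
  split.
    move=> tau tau0 i j.
    rewrite (_ : (fun p => _) = fun p => (Num.sqrt 2)^-1 * el_val e p.1 p.2 i j).
      2: by apply/funext => p; rewrite mxE.
    apply: measurable_funM; first exact: measurable_cst.
    exact: el_val_progressive he tau tau0 i j.
  move=> s w _; rewrite mxfrobZ gtr0_norm ?invr_gt0// mulrC ler_pdivrMr// mul1r.
  exact: (el_val_mxfrob_le he (ltW s20)).
split; first by move=> i; have [[]] := el_int_moments he i.
exists (fun=> e); split => //.
- under eq_fun do under eq_integral do under eq_integral do
    rewrite scalerA mulfV ?gt_eqF// scale1r subrr mxfrob0 expr0n/=.
  under eq_fun do under eq_integral do rewrite integral0.
  under eq_fun do rewrite integral0.
  exact: cvg_cst.
- under eq_fun do under eq_integral do rewrite subrr enorm_sqn sqn0.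
  under eq_fun do rewrite integral0.
  exact: cvg_cst.
Qed.

End elementary_integrals.

(** * Lower bound and semiconcavity of the value function *)

Section value_function.
Context {R : realType} {d : nat} {disp : measure_display}
  {T : measurableType disp} (P : probability T R) (W : R -> T -> 'rV[R]_d).
Hypothesis bW : is_brownian P W.
Implicit Types (t : R) (x k : 'rV[R]_d).

Definition rvL2 (I : T -> 'rV[R]_d) := forall i, L2 P (fun w => I w 0 i).

Lemma rvL2_sqn (I : T -> 'rV[R]_d) : rvL2 I -> L1 P (fun w => sqn (I w)).
Proof.
by move=> lI; apply: L1_sum => i; exact: L2M.
Qed.

Lemma rvL2_shift (I : T -> 'rV[R]_d) x : rvL2 I -> rvL2 (fun w => x + I w).
Proof.
move=> lI i; under eq_fun do rewrite mxE.
by apply: L2D; [exact: L2_cst|exact: lI].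
Qed.

Lemma ito_integral_moments sigma t I : is_ito_integral P W sigma t I ->
  rvL2 I /\ forall i, Ex P (fun w => I w 0 i) = 0.
Proof.
move=> [mI [e [he _ cvgI]]].
pose D n w := I w - el_int W (e n) w.
have mD n i : measurable_fun [set: T] (fun w => D n w 0 i).
  rewrite (_ : (fun w => _) = fun w => I w 0 i - el_int W (e n) w 0 i); last first.
    by apply/funext => w; rewrite !mxE.
  by apply: measurable_funB => //; have [[]] := el_int_moments bW (he n) i.
have mDn n : measurable_fun [set: T] (fun w => sqn (D n w)).
  by apply: measurable_sum => i; exact: measurable_funM.
(* The convergence is in the extended reals: the index has to make the integral finite as well as
   small. *)
have small c : 0 < c -> exists n, L1 P (fun w => sqn (D n w)) /\
    Ex P (fun w => sqn (D n w)) <= c.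
  move=> c0; have /fine_cvgP[_ /cvgrPdist_lt /(_ c c0)] := cvgI.
  move=> hfin.
  have /fine_cvgP[[N1 _ h1] _] := cvgI.
  case: hfin => N2 _ h2.
  exists (maxn N1 N2).
  have := h1 _ (leq_maxl N1 N2); have := h2 _ (leq_maxr N1 N2).
  rewrite /= sub0r normrN.
  rewrite (_ : (fun w => _) = fun w => (sqn (D (maxn N1 N2) w))%:E); last first.
    by apply/funext => w; rewrite enorm_sqn.
  move=> h fin.
  have l1 : L1 P (fun w => sqn (D (maxn N1 N2) w)).
    apply/integrableP; split; first exact/measurable_EFinP.
    under eq_integral do rewrite /= ger0_norm ?sqn_ge0//.
    by rewrite ltey_eq fin.
  by split => //; apply: ltW; apply: le_lt_trans h; exact: ler_norm.
have l2D n : L1 P (fun w => sqn (D n w)) -> rvL2 (D n).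
  move=> l1 i; split => //; apply: L1_le l1 => [|w]; first exact: measurable_funX.
  by rewrite ger0_norm ?sqr_ge0// sqn_coord.
have ID n i : (fun w => I w 0 i) = (fun w => D n w 0 i + el_int W (e n) w 0 i).
  by apply/funext => w; rewrite !mxE subrK.
have lI : rvL2 I.
  have [n [l1 _]] := small 1 ltr01; move=> i; rewrite (ID n).
  by apply: L2D; [exact: l2D|have [] := el_int_moments bW (he n) i].
split => // i; apply/eqP; rewrite -normr_le0; apply/ler_addgt0Pr => z z0.
rewrite add0r; pose c := z / 2.
have c0 : 0 < c by rewrite divr_gt0.
have [n [l1 hc]] := small (c ^+ 2) (exprn_gt0 2 c0).
have l2 := l2D n l1 i.
have [l2e e0] := el_int_moments bW (he n) i.
rewrite (ID n) ExD ?e0 ?addr0; [|exact: L2_L1 l2|exact: L2_L1 l2e].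
apply: le_trans (Ex_sqr_small l2 c0) _.
have : Ex P (fun w => D n w 0 i ^+ 2) <= c ^+ 2.
  apply: le_trans hc; apply: Ex_le => //; first by case: l2.
  by move=> w; exact: sqn_coord.
move=> h.
have : c^-1 * Ex P (fun w => D n w 0 i ^+ 2) <= c^-1 * c ^+ 2.
  by rewrite ler_wpM2l// invr_ge0 ltW.
have -> : c^-1 * c ^+ 2 = c by field; rewrite gt_eqF.
by rewrite /c; lra.
Qed.

Variables (u0 : 'rV[R]_d -> R) (L C : R).
Hypothesis u0_cont : continuous u0.
Hypothesis u0_taylor :
  forall x k, `|u0 (x + k) - u0 x - dotv (grad u0 x) k| <= L * sqn k.
Hypothesis u0_growth : forall x, `|u0 x| <= C * (1 + sqn x).

Lemma rvL2_u0 I x : rvL2 I -> L1 P (fun w => u0 (x + I w)).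
Proof.
move=> /(rvL2_shift x) lI.
apply: (@L1_le _ _ _ P _ (fun w => C * (1 + sqn (x + I w)))).
- apply: (measurable_continuous_coord (X := fun w => x + I w) u0_cont) => i.
  by case: (lI i).
- by move=> w.
- by apply: L1Z; apply: L1D; [exact: L1_cst|exact: rvL2_sqn].
Qed.

Definition controlled t (I : T -> 'rV[R]_d) := exists sigma,
  admissible W sigma /\ is_ito_integral P W (fun s w => Num.sqrt 2 *: sigma s w) t I.

Lemma value_set t x :
  [set c : \bar R | exists sigma I, [/\ admissible W sigma,
     is_ito_integral P W (fun s w => Num.sqrt 2 *: sigma s w) t I &
     c = ('E_P[fun w => u0 (x + I w)%R])%E]] =
  [set (Ex P (fun w => u0 (x + I w)))%:E | I in controlled t].
Proof.
apply/seteqP; split => c.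
  move=> [sigma [I [h1 h2 ->]]]; exists I; first by exists sigma.
  have [lI _] := ito_integral_moments h2.
  by rewrite unlock -ExE//; exact: rvL2_u0.
move=> [I [sigma [h1 h2]] <-]; exists sigma, I; split => //.
have [lI _] := ito_integral_moments h2.
by rewrite unlock -ExE//; exact: rvL2_u0.
Qed.

Lemma controlled_moments t I : controlled t I ->
  rvL2 I /\ forall i, Ex P (fun w => I w 0 i) = 0.
Proof. by move=> [sigma [_ /ito_integral_moments]]. Qed.

(** The zero control bounds the infimum from above, so that [fine] in [value] loses nothing; it also
    gives $u(t,\cdot) \le u_0$. *)
Lemma controlled0 t : 0 <= t -> controlled t (fun=> 0).
Proof.
move=> t0.
pose e : @elementary R d disp T := Elementary 1%N (fun k : nat => if k == 0%N then 0 else t)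
  (fun _ _ => 0).
have he : is_elementary W t e.
  split => //=.
  - by move=> [|k].
  - by exists 0 => k w _; rewrite mxfrob0.
have [|sigma [h1 h2]] := elementary_control bW he.
  by move=> k w _; rewrite mxfrob0 sqrtr_ge0.
exists sigma; split; first exact: h1.
rewrite (_ : (fun=> 0) = el_int W e); first exact: h2.
apply/funext => w.
by rewrite /el_int big1// => k _; rewrite trmx0 mulmx0.
Qed.

Variable v : 'rV[R]_d -> R.
Hypothesis v_le : forall x, v x <= u0 x.
Hypothesis v_subgradient : forall x e, 0 < e ->
  exists p, forall k, v x + dotv p k - e * (1 + sqn k) <= v (x + k).

Lemma controlled_ge t I x : controlled t I -> v x <= Ex P (fun w => u0 (x + I w)).
Proof.
move=> /controlled_moments[lI I0]; apply/ler_addgt0Pr => z z0.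
have lq := rvL2_sqn lI.
(* The subgradient error $(z/A)(1+|I|^2)$ then integrates to exactly [z]. *)
pose A := 1 + Ex P (fun w => sqn (I w)).
have A0 : 0 < A by rewrite ltr_wpDr// Ex_ge0// => w; exact: sqn_ge0.
have [p hp] := v_subgradient x (divr_gt0 z0 A0).
have ldot : L1 P (fun w => dotv p (I w)).
  by apply: L1_sum => i; apply: L1Z; exact: L2_L1.
have Edot : Ex P (fun w => dotv p (I w)) = 0.
  rewrite Ex_sum => [|i]; last by apply: L1Z; exact: L2_L1.
  by rewrite big1// => i _; rewrite ExZ ?I0 ?mulr0//; exact: L2_L1.
have l1 : L1 P (fun w => 1 + sqn (I w)) by apply: L1D => //; exact: L1_cst.
have lrhs : L1 P (fun w => v x + dotv p (I w) - z / A * (1 + sqn (I w))).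
  by apply: L1B; [apply: L1D => //; exact: L1_cst|exact: L1Z].
rewrite -lerBlDr.
have <- : Ex P (fun w => v x + dotv p (I w) - z / A * (1 + sqn (I w))) = v x - z.
  rewrite ExB; [|by apply: L1D => //; exact: L1_cst|exact: L1Z].
  rewrite ExD//; last exact: L1_cst.
  rewrite Ex_cst Edot addr0 ExZ// ExD//; last exact: L1_cst.
  by rewrite Ex_cst -/A mulfVK// gt_eqF.
apply: Ex_le => //; first exact: rvL2_u0.
by move=> w; apply: le_trans (hp _) (v_le _).
Qed.

Let valueE t x : value P W u0 t x =
  fine (ereal_inf [set (Ex P (fun w => u0 (x + I w)))%:E | I in controlled t]).
Proof. by rewrite /value value_set. Qed.

Let inf_fin t x : 0 <= t ->
  ereal_inf [set (Ex P (fun w => u0 (x + I w)))%:E | I in controlled t] =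
    (value P W u0 t x)%:E.
Proof.
move=> t0; rewrite valueE fineK//.
set S := (X in ereal_inf X).
have h1 : ((v x)%:E <= ereal_inf S)%E.
  by apply: le_ereal_inf_tmp => _ [I cI <-]; rewrite lee_fin; exact: controlled_ge cI.
have h2 : (ereal_inf S <= (Ex P (fun w => u0 (x + 0)))%:E)%E.
  by apply: ereal_inf_lbound; exists (fun=> 0) => //; exact: controlled0.
rewrite fin_numElt (lt_le_trans _ h1) ?ltNyr//=.
by rewrite (le_lt_trans h2)// ltry.
Qed.

Lemma value_ge t x : 0 <= t -> v x <= value P W u0 t x.
Proof.
move=> t0; rewrite -lee_fin -inf_fin//.
by apply: le_ereal_inf_tmp => _ [I cI <-]; rewrite lee_fin; exact: controlled_ge cI.
Qed.

Lemma value_le t x I : 0 <= t -> controlled t I ->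
  value P W u0 t x <= Ex P (fun w => u0 (x + I w)).
Proof.
move=> t0 cI; rewrite -lee_fin -inf_fin//.
by apply: ereal_inf_lbound; exists I.
Qed.

Lemma value_le_u0 t x : 0 <= t -> value P W u0 t x <= u0 x.
Proof.
move=> t0; have := value_le x t0 (controlled0 t0).
by under eq_fun do rewrite addr0; rewrite Ex_cst.
Qed.

Lemma value_approx t x e : 0 <= t -> 0 < e ->
  exists2 I, controlled t I & Ex P (fun w => u0 (x + I w)) <= value P W u0 t x + e.
Proof.
move=> t0 e0.
have : (ereal_inf [set (Ex P (fun w => u0 (x + I w)))%:E | I in controlled t]
   < (value P W u0 t x + e)%:E)%E.
  by rewrite inf_fin// lte_fin ltrDl.
move=> /ereal_inf_lt[_ [I cI <-]]; rewrite lte_fin => h.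
by exists I => //; exact: ltW.
Qed.

(** One nearly optimal control for [x] is also used at the two other points, and
    [taylor_three_points] is averaged. *)
Lemma value_three_points t x k r s : 0 <= t -> 0 < r -> 0 < s ->
  r * value P W u0 t (x - s *: k) + s * value P W u0 t (x + r *: k) <=
    (r + s) * value P W u0 t x + L * (r * s ^+ 2 + s * r ^+ 2) * sqn k.
Proof.
move=> t0 r0 s0; apply/ler_addgt0Pr => z z0.
have rs0 : 0 < r + s by rewrite addr_gt0.
have [I cI hI] := value_approx x t0 (divr_gt0 z0 rs0).
have [lI _] := controlled_moments cI.
have l y : L1 P (fun w => u0 (y + I w)) by exact: rvL2_u0.
have h1 : r * value P W u0 t (x - s *: k) <=
    r * Ex P (fun w => u0 (x - s *: k + I w)).
  by rewrite ler_pM2l//; exact: value_le.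
have h2 : s * value P W u0 t (x + r *: k) <=
    s * Ex P (fun w => u0 (x + r *: k + I w)).
  by rewrite ler_pM2l//; exact: value_le.
have h3 : (r + s) * Ex P (fun w => u0 (x + I w)) <= (r + s) * value P W u0 t x + z.
  have -> : (r + s) * value P W u0 t x + z =
      (r + s) * (value P W u0 t x + z / (r + s)) by field; rewrite gt_eqF.
  by rewrite ler_pM2l.
have : r * Ex P (fun w => u0 (x - s *: k + I w)) +
    s * Ex P (fun w => u0 (x + r *: k + I w)) <=
    (r + s) * Ex P (fun w => u0 (x + I w)) + L * (r * s ^+ 2 + s * r ^+ 2) * sqn k.
  rewrite -!ExZ// -ExD; [|exact: L1Z|exact: L1Z].
  rewrite -[X in _ <= _ + X](Ex_cst P) -ExD; [|exact: L1Z|exact: L1_cst].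
  apply: Ex_le.
  - by apply: L1D; exact: L1Z.
  - by apply: L1D; [exact: L1Z|exact: L1_cst].
  - move=> w; have := @taylor_three_points _ _ u0 L (x + I w) k r s u0_taylor r0 s0.
    by rewrite [x - _ + _]addrAC [x + _ + I w]addrAC.
lra.
Qed.

End value_function.

(** * Exponential upper bound for the value function *)

Section weights.
Context {R : realType} {d : nat} {I : finType}.
Variables (y : I -> 'rV[R]_d) (rho kap0 eta : R).
Hypotheses (rho0 : 0 < rho) (kap00 : 0 < kap0) (eta0 : 0 < eta).
Hypothesis y_rho : forall i l, `|y i 0 l| <= rho.
Implicit Types (a : I -> R) (j l : 'I_d) (g : R).

(* Weights a on the points y are updated by a_i (1 + c_i g) with g Gaussian and
   c_i = wcoef a j i, which moves the barycenter along the j-th column of the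
   covariance matrix. Dividing by the standard deviation of the j-th coordinate
   makes its variance decay exponentially; eta keeps c_i bounded. A Gaussian
   step may produce a negative weight: walive then freezes the process, and
   wdead controls the error. *)
Definition wmean a l : R := \sum_i a i * y i 0 l.
Definition wvar a l : R := \sum_i a i * y i 0 l ^+ 2 - wmean a l ^+ 2.
Definition walive a : R := \prod_i (0 <= a i)%R%:R.
Definition wcoef a j i : R :=
  walive a * (kap0 / Num.sqrt (wvar a j + eta) * (y i 0 j - wmean a j)).
Definition wstep a j g : I -> R := fun i => a i * (1 + wcoef a j i * g).
Definition wdrift a j l : R := \sum_i a i * wcoef a j i * y i 0 l.
Definition wcross a j l : R :=
  \sum_i a i * wcoef a j i * y i 0 l ^+ 2 - 2 * wmean a l * wdrift a j l.
Definition wbound : R := kap0 / Num.sqrt eta * (2 * rho).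
Definition wdead a : R := (1 - walive a) * (1 + \sum_i `|a i|) ^+ 2.

Lemma walive1 a : (forall i, 0 <= a i) -> walive a = 1.
Proof. by move=> h; rewrite /walive big1// => i _; rewrite h. Qed.

Lemma walive0 a i : a i < 0 -> walive a = 0.
Proof. by move=> h; rewrite /walive (bigD1 i)//= leNgt h mul0r. Qed.

Lemma walive_cases a :
  (walive a = 1 /\ forall i, 0 <= a i) \/ (walive a = 0 /\ exists i, a i < 0).
Proof.
have [/forallP h|] := boolP [forall i, 0 <= a i].
  by left; split => //; exact: walive1.
rewrite negb_forall => /existsP[i]; rewrite -ltNge => h; right.
by split; [exact: walive0 h|exists i].
Qed.

Lemma wvarE a l : \sum_i a i = 1 ->
  wvar a l = \sum_i a i * (y i 0 l - wmean a l) ^+ 2.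
Proof.
move=> a1; rewrite /wvar.
have E i : a i * (y i 0 l - wmean a l) ^+ 2 = a i * y i 0 l ^+ 2 +
   (- (2 * wmean a l) * (a i * y i 0 l) + wmean a l ^+ 2 * a i) by ring.
under [RHS]eq_bigr do rewrite E.
by rewrite !big_split/= -!mulr_sumr a1 -/(wmean a l); ring.
Qed.

Section alive.
Variable a : I -> R.
Hypotheses (a0 : forall i, 0 <= a i) (a1 : \sum_i a i = 1).

Lemma alive_mean_le (z : I -> R) M : (forall i, `|z i| <= M) ->
  `|\sum_i a i * z i| <= M.
Proof.
move=> zM; apply: (le_trans (ler_norm_sum _ _ _)).
have -> : M = \sum_i a i * M by rewrite -mulr_suml a1 mul1r.
by apply: ler_sum => i _; rewrite normrM ger0_norm// ler_wpM2l.
Qed.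

Lemma alive_le1 i : a i <= 1.
Proof. by rewrite -a1 (bigD1 i)//= lerDl sumr_ge0. Qed.

Lemma alive_wmean l : `|wmean a l| <= rho.
Proof. exact: alive_mean_le. Qed.

Lemma alive_wvar_ge0 l : 0 <= wvar a l.
Proof. by rewrite wvarE//; apply: sumr_ge0 => i _; rewrite mulr_ge0// sqr_ge0. Qed.

Lemma alive_wvar_le l : wvar a l <= rho ^+ 2.
Proof.
rewrite /wvar lerBlDr (le_trans _ (_ : rho ^+ 2 <= _))//; last by rewrite lerDl sqr_ge0.
have : `|\sum_i a i * y i 0 l ^+ 2| <= rho ^+ 2.
  by apply: alive_mean_le => i; rewrite normrX ler_pXn2r ?nnegrE// ltW.
by apply: le_trans; exact: ler_norm.
Qed.

Let sd j := Num.sqrt (wvar a j + eta).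

Let sd0 j : 0 < sd j.
Proof. by rewrite sqrtr_gt0 ltr_wpDl// alive_wvar_ge0. Qed.

Let sdE j : sd j ^+ 2 = wvar a j + eta.
Proof. by rewrite sqr_sqrtr// addr_ge0 ?alive_wvar_ge0// ltW. Qed.

Lemma alive_wcoef j i : `|wcoef a j i| <= wbound.
Proof.
rewrite /wcoef walive1// mul1r normrM /wbound ler_pM//.
  rewrite ger0_norm; last by rewrite divr_ge0 ?sqrtr_ge0// ltW.
  rewrite ler_pM2l// lef_pV2 ?posrE ?sqrtr_gt0//; last first.
    by rewrite ltr_wpDl// alive_wvar_ge0.
  by rewrite ler_wsqrtr// lerDr alive_wvar_ge0.
by apply: (le_trans (ler_normB _ _)); have := y_rho i j; have := alive_wmean j; lra.
Qed.

(** Unlike [wbound] this is free of [eta]: by Young the mean of $|z|/sd$ is at most $(V/sd^2 + 1)/2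
    \le 1$. It keeps the control admissible however small [eta] is. *)
Lemma alive_wcoef_mean j : \sum_i a i * `|wcoef a j i| <= kap0.
Proof.
have s0 := sd0 j.
have step i : a i * `|wcoef a j i| <=
    kap0 / sd j * (2^-1 * ((sd j)^-1 * (a i * (y i 0 j - wmean a j) ^+ 2) + sd j * a i)).
  rewrite /wcoef walive1// mul1r normrM gtr0_norm ?divr_gt0//.
  rewrite -/(sd j) mulrCA ler_pM2l ?divr_gt0//.
  set z := y i 0 j - _.
  have -> : 2^-1 * ((sd j)^-1 * (a i * z ^+ 2) + sd j * a i) =
      a i * (2^-1 * ((sd j)^-1 * z ^+ 2 + sd j)) by ring.
  rewrite ler_wpM2l// -(ler_pM2l s0).
  have -> : sd j * (2^-1 * ((sd j)^-1 * z ^+ 2 + sd j)) = 2^-1 * (z ^+ 2 + sd j ^+ 2).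
    by field; rewrite gt_eqF.
  by have := sqr_ge0 (`|z| - sd j); have := real_normK (num_real z); nra.
apply: (le_trans (ler_sum _ (fun i _ => step i))).
rewrite -mulr_sumr -mulr_sumr big_split/= -!mulr_sumr a1 -wvarE// mulr1.
have kE : kap0 / sd j * sd j = kap0 by rewrite mulfVK// gt_eqF.
rewrite -[leRHS]kE ler_pM2l ?divr_gt0// -(ler_pM2l s0).
have -> : sd j * (2^-1 * ((sd j)^-1 * wvar a j + sd j)) =
  2^-1 * (wvar a j + sd j ^+ 2) by field; rewrite gt_eqF.
rewrite -[leRHS]expr2 sdE.
have := eta0; set V := wvar a j.
lra.
Qed.

Lemma alive_wdrift j l : `|wdrift a j l| <= rho * kap0.
Proof.
apply: (le_trans (ler_norm_sum _ _ _)).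
apply: (@le_trans _ _ (\sum_i rho * (a i * `|wcoef a j i|))).
  apply: ler_sum => i _; rewrite !normrM (ger0_norm (a0 i)) mulrC.
  by rewrite ler_wpM2r// mulr_ge0.
by rewrite -mulr_sumr ler_pM2l// alive_wcoef_mean.
Qed.

(** The diagonal drift is $\kappa_0 V/\sqrt{V+\eta}$, and $V^2/(V+\eta) \ge V - \eta$. *)
Lemma alive_wdrift_diag j : kap0 ^+ 2 * (wvar a j - eta) <= wdrift a j j ^+ 2.
Proof.
have -> : wdrift a j j = kap0 / sd j * wvar a j.
  rewrite wvarE// mulr_sumr /wdrift /wcoef walive1//.
  have z : \sum_i a i * (y i 0 j - wmean a j) = 0.
    under eq_bigr do rewrite mulrBr.
    by rewrite sumrB -mulr_suml a1 mul1r subrr.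
  transitivity (\sum_i kap0 / sd j * (a i * (y i 0 j - wmean a j) ^+ 2) +
      kap0 / sd j * wmean a j * \sum_i a i * (y i 0 j - wmean a j)); last first.
    by rewrite z mulr0 addr0.
  rewrite [X in _ = _ + X]mulr_sumr.
  by rewrite -big_split/=; apply: eq_bigr => i _; rewrite -/(sd j); ring.
have V0 := alive_wvar_ge0 j.
rewrite !exprMn exprVn sdE -mulrA ler_pM2l ?exprn_gt0//.
rewrite mulrC ler_pdivlMr ?ltr_wpDl//.
by have := sqr_ge0 eta; lra.
Qed.

End alive.

Lemma wcoef_dead a j i : walive a = 0 -> wcoef a j i = 0.
Proof. by move=> h; rewrite /wcoef h mul0r. Qed.

Lemma wstep_dead a j g : walive a = 0 -> wstep a j g = a.
Proof. by move=> h; apply/funext => i; rewrite /wstep wcoef_dead// mul0r addr0 mulr1. Qed.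

Lemma wcoef_sum0 a j : \sum_i a i = 1 -> \sum_i a i * wcoef a j i = 0.
Proof.
move=> a1; rewrite /wcoef.
under eq_bigr do rewrite mulrCA [X in _ * X]mulrCA.
rewrite -mulr_sumr -mulr_sumr.
under eq_bigr do rewrite mulrBr.
by rewrite sumrB -mulr_suml a1 mul1r subrr !mulr0.
Qed.

Lemma wstep_sum a j g : \sum_i a i = 1 -> \sum_i wstep a j g i = 1.
Proof.
move=> a1; rewrite /wstep.
under eq_bigr do rewrite mulrDr mulr1 mulrA.
by rewrite big_split/= -mulr_suml wcoef_sum0// mul0r addr0.
Qed.

Lemma wstep_mean a j g l : wmean (wstep a j g) l = wmean a l + wdrift a j l * g.
Proof.
rewrite /wmean /wdrift mulr_suml -big_split/=.
by apply: eq_bigr => i _; rewrite /wstep; ring.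
Qed.

(** Second moments are linear in the weights, so the term in $g^2$ comes from the squared mean alone
    and has a sign: on average no coordinate variance increases, whatever [j] is. *)
Lemma wstep_var a j g l : wvar (wstep a j g) l =
  wvar a l + wcross a j l * g - wdrift a j l ^+ 2 * g ^+ 2.
Proof.
rewrite /wvar wstep_mean /wcross.
have -> : \sum_i wstep a j g i * y i 0 l ^+ 2 = \sum_i a i * y i 0 l ^+ 2 +
    (\sum_i a i * wcoef a j i * y i 0 l ^+ 2) * g.
  rewrite mulr_suml -big_split/=.
  by apply: eq_bigr => i _; rewrite /wstep; ring.
ring.
Qed.

Lemma wcoef_bounded a j i : \sum_i a i = 1 -> `|a i * wcoef a j i| <= wbound.
Proof.
have b0 : 0 <= wbound by rewrite mulr_ge0 ?divr_ge0 ?sqrtr_ge0 ?mulr_ge0 ?(ltW kap00) ?(ltW rho0).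
move=> a1; have [[_ a0]|[h _]] := walive_cases a; last first.
  by rewrite wcoef_dead// mulr0 normr0.
rewrite normrM (ger0_norm (a0 i)) -[leRHS]mul1r ler_pM//.
  exact: alive_le1.
exact: alive_wcoef.
Qed.

Lemma wdrift_dead a j l : walive a = 0 -> wdrift a j l = 0.
Proof. by move=> h; rewrite /wdrift big1// => i _; rewrite wcoef_dead// mulr0 mul0r. Qed.

Lemma wdrift_bounded a j l : \sum_i a i = 1 -> `|wdrift a j l| <= rho * kap0.
Proof.
move=> a1; have [[_ a0]|[h _]] := walive_cases a; first exact: alive_wdrift.
by rewrite wdrift_dead// normr0 mulr_ge0// ltW.
Qed.

(** Boundedness, not the size of the bound, is what makes the linear term of [wstep_var] average to
    zero. *)
Lemma wcross_bounded a j l : \sum_i a i = 1 ->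
  `|wcross a j l| <= \sum_(i : I) wbound * rho ^+ 2 + 2 * rho * (rho * kap0).
Proof.
move=> a1; have [[_ a0]|[h _]] := walive_cases a; last first.
  rewrite /wcross wdrift_dead// big1 => [|i _].
    rewrite mulr0 subr0 normr0 addr_ge0//.
      by apply: sumr_ge0 => i _; rewrite mulr_ge0 ?sqr_ge0// (le_trans _ (wcoef_bounded j i a1)).
    by rewrite !mulr_ge0// ltW.
  by rewrite wcoef_dead// mulr0 mul0r.
apply: (le_trans (ler_normB _ _)); rewrite lerD//.
  apply: (le_trans (ler_norm_sum _ _ _)); apply: ler_sum => i _.
  rewrite normrM ler_pM//; first exact: wcoef_bounded.
  by rewrite normrX ler_pXn2r ?nnegrE// ltW.
rewrite !normrM ler_pM//; first by rewrite normr_nat ler_pM2l// alive_wmean.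
exact: alive_wdrift.
Qed.

(** Frozen weights have no drift, so the left side must then be nonpositive. It is, because $V \le
    \rho^2 \sum_i |a_i|$ is dominated by the [wdead] term. *)
Lemma wdrift_diag a j : \sum_i a i = 1 ->
  kap0 ^+ 2 * (wvar a j - eta - rho ^+ 2 * wdead a) <= wdrift a j j ^+ 2.
Proof.
move=> a1; have [[h a0]|[h _]] := walive_cases a.
  by rewrite /wdead h subrr mul0r mulr0 subr0; exact: alive_wdrift_diag.
rewrite wdrift_dead// expr0n/= mulr_ge0_le0 ?sqr_ge0//.
rewrite /wdead h subr0 mul1r.
set S := \sum_i `|a i|.
have S0 : 0 <= S by exact: sumr_ge0.
have : wvar a j <= rho ^+ 2 * S.
  rewrite /wvar lerBlDr (le_trans _ (_ : rho ^+ 2 * S <= _))//; last first.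
    by rewrite lerDl sqr_ge0.
  rewrite /S mulr_sumr; apply: ler_sum => i _; rewrite mulrC.
  apply: (@le_trans _ _ (y i 0 j ^+ 2 * `|a i|)).
    by rewrite ler_wpM2l ?sqr_ge0// ler_norm.
  rewrite ler_wpM2r// -(real_normK (num_real (y i 0 j))).
  by rewrite ler_pXn2r ?nnegrE// ltW.
have : rho ^+ 2 * S <= rho ^+ 2 * (1 + S) ^+ 2.
  by rewrite ler_wpM2l ?sqr_ge0//; nra.
move=> h1 h2; rewrite -addrA -opprD subr_le0 (le_trans h2)// (le_trans h1)//.
by rewrite lerDr ltW.
Qed.

Lemma wdead_ge0 a : 0 <= wdead a.
Proof.
have [[h _]|[h _]] := walive_cases a; rewrite /wdead h ?subrr ?subr0 ?mul0r ?mul1r//.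
by rewrite sqr_ge0.
Qed.

(** A weight turns negative only if $z = K|g| > 1$, with $K$ the bound [wbound], and then
    $(1+\sum_i|a_i|)^2 \le (2+z)^2 \le 9z^2 \le 9z^4$. The fourth power makes a step cost $O(h^2)$,
    so $O(1/h)$ steps cost $O(h)$. *)
Lemma wdead_step a j g : \sum_i a i = 1 ->
  wdead (wstep a j g) <= wdead a + 9 * wbound ^+ 4 * g ^+ 4.
Proof.
move=> a1; have g4 : 0 <= 9 * wbound ^+ 4 * g ^+ 4.
  by rewrite mulr_ge0 ?exprn_even_ge0// mulr_ge0// exprn_even_ge0.
have [[h a0]|[h _]] := walive_cases a; last first.
  by rewrite wstep_dead// lerDl.
have [[h' _]|[h' [i ai]]] := walive_cases (wstep a j g).
  by rewrite /wdead h' subrr mul0r addr_ge0// wdead_ge0.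
rewrite /wdead h h' subrr subr0 mul0r mul1r add0r.
have K0 : 0 <= wbound by apply: (le_trans _ (wcoef_bounded j i a1)).
have ci k : `|wcoef a j k * g| <= wbound * `|g|.
  by rewrite normrM ler_wpM2r// alive_wcoef.
have Kg : 1 < wbound * `|g|.
  apply: lt_le_trans (ci i).
  have : 1 + wcoef a j i * g < 0.
    rewrite ltNge; apply/negP => pos; move: ai.
    by rewrite /wstep ltNge mulr_ge0.
  by have := ler_norm (- (wcoef a j i * g)); rewrite normrN; lra.
have S : \sum_k `|wstep a j g k| <= 1 + wbound * `|g|.
  have -> : 1 + wbound * `|g| = \sum_k a k * (1 + wbound * `|g|).
    by rewrite -mulr_suml a1 mul1r.
  apply: ler_sum => k _; rewrite /wstep normrM (ger0_norm (a0 k)) ler_wpM2l//.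
  by apply: (le_trans (ler_normD _ _)); rewrite normr1 lerD2l.
have -> : 9 * wbound ^+ 4 * g ^+ 4 = 9 * (wbound * `|g|) ^+ 4.
  have g4' : `|g| ^+ 4 = g ^+ 4 by rewrite -normrX ger0_norm// exprn_even_ge0.
  by rewrite (exprMn 4 wbound `|g|) g4'; ring.
move: Kg S; set z := wbound * `|g|; set s := \sum_k _ => z1 sz.
have s0 : 0 <= s by exact: sumr_ge0.
have : (1 + s) ^+ 2 <= (2 + z) ^+ 2 by rewrite ler_pXn2r ?nnegrE//; lra.
have z2 : z <= z ^+ 2 by nra.
have z4 : z ^+ 2 <= z ^+ 4.
  have -> : z ^+ 4 = z ^+ 2 * z ^+ 2 by ring.
  by rewrite ler_peMr ?sqr_ge0//; lra.
nra.
Qed.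

End weights.

Section weights_measurability.
Context {R : realType} {d : nat} {I : finType} {disp : measure_display}
  {T : measurableType disp}.
Variables (y : I -> 'rV[R]_d) (kap0 eta : R) (A : T -> I -> R).
Hypothesis mA : forall i, measurable_fun [set: T] (fun w => A w i).

Lemma measurable_wmean l : measurable_fun [set: T] (fun w => wmean y (A w) l).
Proof. by apply: measurable_sum => i; apply: measurable_funM. Qed.

Lemma measurable_wvar l : measurable_fun [set: T] (fun w => wvar y (A w) l).
Proof.
apply: measurable_funB; last by apply: measurable_funX; exact: measurable_wmean.
by apply: measurable_sum => i; apply: measurable_funM.
Qed.

Lemma measurable_walive : measurable_fun [set: T] (fun w => walive (A w)).
Proof.
have m1 i : measurable_fun [set: T] (fun w => (0 <= A w i)%R%:R : R).
  rewrite (_ : (fun w => _) = \1_(`[0, +oo[%classic : set R) \o (fun w => A w i)).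
    by apply: measurableT_comp => //; exact: measurable_indic.
  by apply/funext => w /=; rewrite indicE mem_setE in_itv/= andbT.
rewrite /walive.
suff: forall s : seq I, measurable_fun [set: T]
  (fun w => \prod_(i <- s) (0 <= A w i)%R%:R : R) by exact.
elim=> [|i s ih]; first by under eq_fun do rewrite big_nil; exact: measurable_cst.
by under eq_fun do rewrite big_cons; exact: measurable_funM.
Qed.

Lemma measurable_wcoef j i :
  measurable_fun [set: T] (fun w => wcoef y kap0 eta (A w) j i).
Proof.
apply: measurable_funM; first exact: measurable_walive.
apply: measurable_funM; last first.
  by apply: measurable_funB => //; exact: measurable_wmean.
apply: measurable_funM => //.
(* The inverse of a nonnegative number as a real power, measurable on the whole line. *)
rewrite (_ : (fun w => _) = (fun z : R => Num.sqrt z `^ (-1)) \o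
    (fun w => wvar y (A w) j + eta)); last first.
  by apply/funext => w /=; rewrite powR_inv1// sqrtr_ge0.
apply: measurableT_comp; last by apply: measurable_funD => //; exact: measurable_wvar.
apply: (measurableT_comp (@measurable_powR R (-1))).
by apply: continuous_measurable_fun; exact: sqrt_continuous.
Qed.

Lemma measurable_wdrift j l :
  measurable_fun [set: T] (fun w => wdrift y kap0 eta (A w) j l).
Proof.
apply: measurable_sum => i; apply: measurable_funM => //.
by apply: measurable_funM => //; exact: measurable_wcoef.
Qed.

Lemma measurable_wcross j l :
  measurable_fun [set: T] (fun w => wcross y kap0 eta (A w) j l).
Proof.
apply: measurable_funB.
  apply: measurable_sum => i; apply: measurable_funM => //.
  by apply: measurable_funM => //; exact: measurable_wcoef.
apply: measurable_funM; last exact: measurable_wdrift.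
by apply: measurable_funM => //; exact: measurable_wmean.
Qed.

Lemma measurable_wdead : measurable_fun [set: T] (fun w => wdead (A w)).
Proof.
apply: measurable_funM.
  by apply: measurable_funB => //; exact: measurable_walive.
apply: measurable_funX; apply: measurable_funD => //.
by apply: measurable_sum => i; exact: measurableT_comp.
Qed.

End weights_measurability.

(** * The weights as a martingale driven by one Brownian coordinate *)

Section weights_process.
Context {R : realType} {d : nat} {disp : measure_display}
  {T : measurableType disp} (P : probability T R) (W : R -> T -> 'rV[R]_d).
Hypothesis bW : is_brownian P W.
Context {I : finType}.
Variables (i0 : 'I_d) (y : I -> 'rV[R]_d) (lam0 : I -> R) (rho kap0 eta h : R).
Variable jj : nat -> 'I_d.
Hypotheses (rho0 : 0 < rho) (kap00 : 0 < kap0) (eta0 : 0 < eta) (h0 : 0 < h).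
Hypothesis y_rho : forall i l, `|y i 0 l| <= rho.
Hypotheses (lam0_ge0 : forall i, 0 <= lam0 i) (lam0_sum : \sum_i lam0 i = 1).
Local Notation K := (wbound rho kap0 eta).
Local Notation E := (Ex P).

Definition noise (k : nat) (w : T) : R :=
  Num.sqrt 2 * incr W (k%:R * h) (k.+1%:R * h) i0 w.

Fixpoint weight (k : nat) (w : T) : I -> R :=
  if k is k'.+1 then wstep y kap0 eta (weight k' w) (jj k') (noise k' w) else lam0.

Let th k := (k%:R * h : R).

Let th_ge0 k : 0 <= th k.
Proof. by rewrite mulr_ge0// ltW. Qed.

Let th_lt k : th k < th k.+1.
Proof. by rewrite ltr_pM2r// ltr_nat. Qed.

Let thB k : th k.+1 - th k = h.
Proof. by rewrite /th -mulrBl -natrB ?subSnn ?mul1r. Qed.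

Lemma weight_sum k w : \sum_i weight k w i = 1.
Proof. by elim: k => [//|k ih] /=; exact: wstep_sum. Qed.

Lemma noise_adapted k : adapted W (th k.+1) (noise k).
Proof.
apply: measurable_funM; first exact: measurable_cst.
apply: measurable_funB.
  exact: adapted_brownian (th_ge0 k.+1) (lexx _).
exact: adapted_brownian (th_ge0 k) (ltW (th_lt k)).
Qed.

Lemma weight_adapted k i : adapted W (th k) (fun w => weight k w i).
Proof.
elim: k i => [|k ih] i; first exact: measurable_cst.
have ihS l : adapted W (th k.+1) (fun w => weight k w l).
  exact: adapted_le (ltW (th_lt k)) (ih l).
apply: measurable_funM; first exact: ihS.
apply: measurable_funD; first exact: measurable_cst.
apply: measurable_funM; last exact: noise_adapted.
exact: (measurable_wcoef (T := g_sigma_algebraType (history W (th k.+1)))).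
Qed.

Lemma noise_L2 k : L2 P (noise k).
Proof. exact: L2Z (incr_L2 bW i0 (th_ge0 k) (ltW (th_lt k))). Qed.

Lemma noise_mul_L2 k (b : T -> R) M : adapted W (th k) b ->
  (forall w, `|b w| <= M) -> L2 P (fun w => b w * noise k w).
Proof.
move=> ab bM; apply: L2Ml_bounded bM (noise_L2 k).
exact: (adapted_measurable bW ab).
Qed.

Lemma noise_mul_eq0 k (b : T -> R) M : adapted W (th k) b ->
  (forall w, `|b w| <= M) -> E (fun w => b w * noise k w) = 0.
Proof.
move=> ab bM.
rewrite (_ : (fun w => _) = fun w => Num.sqrt 2 *
    (b w * incr W (th k) (th k.+1) i0 w)); last first.
  by apply/funext => w; rewrite /noise mulrCA.
rewrite ExZ; first by rewrite (@incr_mul_eq0 _ _ _ _ P W bW _ _ _ _ M) ?mulr0// ltW.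
apply: L2_L1; apply: L2Ml_bounded bM _; first exact: (adapted_measurable bW ab).
exact: (incr_L2 bW i0 (th_ge0 k) (ltW (th_lt k))).
Qed.

Lemma noise_sqr_ge k (b : T -> R) M : adapted W (th k) b ->
  (forall w, 0 <= b w <= M) ->
  L1 P (fun w => b w * noise k w ^+ 2) /\
  2 * h / 3 * E b <= E (fun w => b w * noise k w ^+ 2).
Proof.
move=> ab bM.
have bM' w : `|b w| <= M by have /andP[b0 ?] := bM w; rewrite ger0_norm.
have [_ lI] : L2 P (incr W (th k) (th k.+1) i0).
  exact: (incr_L2 bW i0 (th_ge0 k) (ltW (th_lt k))).
have l1 : L1 P (fun w => b w * incr W (th k) (th k.+1) i0 w ^+ 2).
  by apply: L1Ml_bounded bM' lI; exact: (adapted_measurable bW ab).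
rewrite (_ : (fun w => b w * noise k w ^+ 2) = fun w => 2 *
    (b w * incr W (th k) (th k.+1) i0 w ^+ 2)); last first.
  by apply/funext => w; rewrite /noise exprMn sqr_sqrtr// mulrCA.
split; first exact: L1Z.
rewrite ExZ//.
have := incr_sqr_ge bW i0 (th_ge0 k) (ltW (th_lt k)) ab bM.
by rewrite thB; lra.
Qed.

Lemma noise_moment4 k :
  L1 P (fun w => noise k w ^+ 4) /\ E (fun w => noise k w ^+ 4) <= 228 * h ^+ 2.
Proof.
have [l1] := incr_moment4 bW i0 (th_ge0 k) (th_lt k).
rewrite thB => le.
rewrite (_ : (fun w => noise k w ^+ 4) = fun w => 4 *
    (incr W (th k) (th k.+1) i0 w ^+ 4)); last first.
  apply/funext => w; rewrite /noise exprMn; congr (_ * _).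
  by rewrite -[4%N]/(2 * 2)%N exprM sqr_sqrtr//; ring.
by split; [exact: L1Z|rewrite ExZ//; lra].
Qed.

Lemma weight_L2 k i : L2 P (fun w => weight k w i).
Proof.
elim: k => [|k ih] /=; first exact: L2_cst.
rewrite (_ : (fun w => _) = fun w => weight k w i +
   (weight k w i * wcoef y kap0 eta (weight k w) (jj k) i) * noise k w); last first.
  by apply/funext => w; rewrite /wstep mulrDr mulr1 mulrA.
apply: L2D => //; apply: (@noise_mul_L2 _ _ K).
  apply: measurable_funM; first exact: weight_adapted.
  apply: (measurable_wcoef (T := g_sigma_algebraType (history W (th k)))) => l.
  exact: weight_adapted.
by move=> w; apply: wcoef_bounded => //; exact: weight_sum.
Qed.

(** The noise is multiplied by a bounded quantity known before the step, so it averages out. This is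
    what preserves the mean of $\sum_i a_i u_0(y_i)$. *)
Lemma weight_mean k i : E (fun w => weight k w i) = lam0 i.
Proof.
elim: k => [|k ih] /=; first exact: Ex_cst.
rewrite (_ : (fun w => _) = fun w => weight k w i +
   (weight k w i * wcoef y kap0 eta (weight k w) (jj k) i) * noise k w); last first.
  by apply/funext => w; rewrite /wstep mulrDr mulr1 mulrA.
have ac : adapted W (th k) (fun w => weight k w i *
    wcoef y kap0 eta (weight k w) (jj k) i).
  apply: measurable_funM; first exact: weight_adapted.
  apply: (measurable_wcoef (T := g_sigma_algebraType (history W (th k)))) => l.
  exact: weight_adapted.
have bc w : `|weight k w i * wcoef y kap0 eta (weight k w) (jj k) i| <= K.
  by apply: wcoef_bounded => //; exact: weight_sum.
rewrite ExD ?ih.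
- by rewrite (noise_mul_eq0 ac bc) addr0.
- by apply: L2_L1; exact: weight_L2.
- by apply: L2_L1; exact: noise_mul_L2 ac bc.
Qed.

Lemma weight_measurable k i : measurable_fun [set: T] (fun w => weight k w i).
Proof. by have := adapted_measurable bW (@weight_adapted k i). Qed.

Definition drift k l w := wdrift y kap0 eta (weight k w) (jj k) l.

Lemma drift_adapted k l : adapted W (th k) (drift k l).
Proof.
apply: (measurable_wdrift (T := g_sigma_algebraType (history W (th k)))) => i.
exact: weight_adapted.
Qed.

Lemma drift_bounded k l w : `|drift k l w| <= rho * kap0.
Proof. by apply: wdrift_bounded => //; exact: weight_sum. Qed.

Lemma wmean_L2 k l : L2 P (fun w => wmean y (weight k w) l).
Proof.
apply: L2_sum => i; under eq_fun do rewrite mulrC.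
by apply: L2Z; exact: weight_L2.
Qed.

Lemma wvar_L1 k l : L1 P (fun w => wvar y (weight k w) l).
Proof.
apply: L1B; last by have [] := wmean_L2 k l.
apply: L1_sum => i; under eq_fun do rewrite mulrC.
by apply: L1Z; apply: L2_L1; exact: weight_L2.
Qed.

Definition mvar k l := E (fun w => wvar y (weight k w) l).

Lemma mvar_step k l :
  mvar k.+1 l <= mvar k l - 2 * h / 3 * E (fun w => drift k l w ^+ 2).
Proof.
have [l2 ge2] : L1 P (fun w => drift k l w ^+ 2 * noise k w ^+ 2) /\
    2 * h / 3 * E (fun w => drift k l w ^+ 2) <=
      E (fun w => drift k l w ^+ 2 * noise k w ^+ 2).
  apply: (@noise_sqr_ge k (fun w => drift k l w ^+ 2) ((rho * kap0) ^+ 2)).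
    by apply: measurable_funX; exact: drift_adapted.
  move=> w; rewrite sqr_ge0/= -(real_normK (num_real (drift k l w))).
  by rewrite ler_pXn2r ?nnegrE// ?drift_bounded// mulr_ge0 ?ltW.
have ac : adapted W (th k) (fun w => wcross y kap0 eta (weight k w) (jj k) l).
  apply: (measurable_wcross (T := g_sigma_algebraType (history W (th k)))) => i.
  exact: weight_adapted.
have bc w := wcross_bounded rho0 kap00 eta0 y_rho (jj k) l (weight_sum k w).
have l1 := L2_L1 (noise_mul_L2 ac bc).
have e1 := noise_mul_eq0 ac bc.
have lv := wvar_L1 k l.
rewrite /mvar /=.
rewrite (_ : (fun w => wvar _ _ _) = fun w => wvar y (weight k w) l +
   wcross y kap0 eta (weight k w) (jj k) l * noise k w -
   drift k l w ^+ 2 * noise k w ^+ 2); last first.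
  by apply/funext => w; rewrite wstep_var.
rewrite ExB//; last exact: L1D.
by rewrite ExD// e1 addr0 lerD2l lerN2.
Qed.

Lemma mvar_nincr k l : mvar k.+1 l <= mvar k l.
Proof.
apply: (le_trans (mvar_step k l)); rewrite gerBl mulr_ge0//.
  by rewrite divr_ge0// mulr_ge0// ltW.
by apply: Ex_ge0 => w; exact: sqr_ge0.
Qed.

Lemma wdead_weight_le k w :
  wdead (weight k w) <= 9 * K ^+ 4 * \sum_(m < k) noise m w ^+ 4.
Proof.
elim: k => [|k ih] /=.
  by rewrite big_ord0 mulr0 /wdead walive1// subrr mul0r.
rewrite big_ord_recr/= mulrDr.
apply: le_trans (lerD ih (lexx _)).
by apply: wdead_step => //; exact: weight_sum.
Qed.

Lemma wdead_moment k : L1 P (fun w => wdead (weight k w)) /\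
  E (fun w => wdead (weight k w)) <= 9 * K ^+ 4 * (k%:R * (228 * h ^+ 2)).
Proof.
have ls : L1 P (fun w => \sum_(m < k) noise m w ^+ 4).
  by apply: L1_sum => m; have [] := noise_moment4 m.
have l1 : L1 P (fun w => wdead (weight k w)).
  apply: L1_le (L1Z (9 * K ^+ 4) ls).
    by apply: measurable_wdead => i; exact: weight_measurable.
  by move=> w; rewrite ger0_norm ?wdead_ge0// wdead_weight_le.
split => //.
have -> : k%:R * (228 * h ^+ 2) = \sum_(m < k) (228 * h ^+ 2).
  by rewrite sumr_const card_ord -[RHS]mulr_natl.
apply: (@le_trans _ _ (9 * K ^+ 4 * E (fun w => \sum_(m < k) noise m w ^+ 4))).
  by rewrite -ExZ//; apply: Ex_le => //; [exact: L1Z|move=> w; exact: wdead_weight_le].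
have K4 : 0 <= 9 * K ^+ 4 by rewrite mulr_ge0// exprn_even_ge0.
rewrite (ler_wpM2l K4)//.
rewrite Ex_sum => [|m]; last by have [] := noise_moment4 m.
by apply: ler_sum => m _; have [] := noise_moment4 m.
Qed.

Lemma mvar_contract k : mvar k.+1 (jj k) <= mvar k (jj k) -
  2 * h / 3 * kap0 ^+ 2 * (mvar k (jj k) - eta -
    rho ^+ 2 * E (fun w => wdead (weight k w))).
Proof.
apply: (le_trans (mvar_step k (jj k))); rewrite lerD2l lerN2 -mulrA.
rewrite ler_wpM2l//; first by rewrite divr_ge0// mulr_ge0// ltW.
have [ld _] := wdead_moment k.
have lv := wvar_L1 k (jj k).
have l1 : L1 P (fun w => wvar y (weight k w) (jj k) - eta - rho ^+ 2 * wdead (weight k w)).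
  by apply: L1B; [apply: L1B => //; exact: L1_cst|exact: L1Z].
have <- : E (fun w => kap0 ^+ 2 * (wvar y (weight k w) (jj k) - eta -
    rho ^+ 2 * wdead (weight k w))) = kap0 ^+ 2 * (mvar k (jj k) - eta -
    rho ^+ 2 * E (fun w => wdead (weight k w))).
  rewrite ExZ// ExB//; [|by apply: L1B => //; exact: L1_cst|exact: L1Z].
  by rewrite ExB//; [rewrite Ex_cst ExZ|exact: L1_cst].
apply: Ex_le; first exact: L1Z.
- apply: L2_L1; apply: (@L2_bounded _ _ _ P _ ((rho * kap0) ^+ 2)).
    by apply: measurable_funX; have := adapted_measurable bW (@drift_adapted k (jj k)).
  move=> w; rewrite normrX ler_pXn2r ?nnegrE// ?drift_bounded// mulr_ge0 ?ltW//.
- by move=> w; apply: wdrift_diag => //; exact: weight_sum.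
Qed.

End weights_process.

Section weights_terminal.
Context {R : realType} {d : nat} {I : finType}.
Variables (y : I -> 'rV[R]_d) (rho : R) (u0 : 'rV[R]_d -> R) (L C : R).
Hypotheses (rho0 : 0 < rho) (L0 : 0 < L) (C0 : 0 < C).
Hypothesis y_rho : forall i l, `|y i 0 l| <= rho.
Hypothesis u0_taylor :
  forall x k, `|u0 (x + k) - u0 x - dotv (grad u0 x) k| <= L * sqn k.
Hypothesis u0_growth : forall x, `|u0 x| <= C * (1 + sqn x).

Lemma sqn_le_coord (x : 'rV[R]_d) M : (forall l, `|x 0 l| <= M) ->
  sqn x <= d%:R * M ^+ 2.
Proof.
move=> xM; rewrite /sqn /dotv.
have -> : d%:R * M ^+ 2 = \sum_(l < d) M ^+ 2.
  by rewrite sumr_const card_ord mulr_natl.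
apply: ler_sum => l _; rewrite -expr2 -(real_normK (num_real _)).
by rewrite ler_pXn2r ?nnegrE// (le_trans _ (xM l)).
Qed.

(** For nonnegative weights this is semiconcavity at the barycenter. Frozen weights may be negative,
    and there quadratic growth bounds every term by a multiple of $(1+\sum_i|a_i|)^2$. *)
Lemma weights_terminal (a : I -> R) : \sum_i a i = 1 ->
  u0 (\row_l wmean y a l) <= \sum_i a i * u0 (y i) + L * \sum_l wvar y a l +
    (2 * C * (1 + d%:R * rho ^+ 2) + L * d%:R * rho ^+ 2) * wdead a.
Proof.
move=> a1; set X := \row_l _.
have [[h a0]|[h _]] := walive_cases a.
  rewrite /wdead h subrr mul0r mulr0 addr0.
  have -> : \sum_l wvar y a l = \sum_i a i * sqn (y i - X).
    rewrite /sqn /dotv; under [RHS]eq_bigr do rewrite mulr_sumr.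
    rewrite exchange_big/=; apply: eq_bigr => l _; rewrite wvarE//.
    by apply: eq_bigr => i _; rewrite !mxE expr2.
  have z : \sum_i a i * dotv (grad u0 X) (y i - X) = 0.
    rewrite /dotv; under eq_bigr do rewrite mulr_sumr.
    rewrite exchange_big/= big1// => l _.
    under eq_bigr do rewrite mulrCA !mxE.
    rewrite -mulr_sumr; under eq_bigr do rewrite mulrBr.
    by rewrite sumrB -mulr_suml a1 mul1r subrr mulr0.
  have : \sum_i a i * (u0 X + dotv (grad u0 X) (y i - X) - L * sqn (y i - X)) <=
      \sum_i a i * u0 (y i).
    apply: ler_sum => i _; rewrite ler_wpM2l//.
    by have := taylor_lb X (y i - X) u0_taylor; rewrite [X + _]addrC subrK.
  under eq_bigr do rewrite mulrBr mulrDr (mulrCA _ L).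
  by rewrite sumrB big_split/= -mulr_suml a1 mul1r z addr0 -mulr_sumr; lra.
rewrite /wdead h subr0 mul1r; set S := \sum_i `|a i|.
have S0 : 0 <= S by exact: sumr_ge0.
have r2 : 0 < rho ^+ 2 by rewrite exprn_gt0.
have wsum (z : I -> R) M : (forall i, `|z i| <= M) -> `|\sum_i a i * z i| <= S * M.
  move=> zM; apply: (le_trans (ler_norm_sum _ _ _)).
  by rewrite mulr_suml; apply: ler_sum => i _; rewrite normrM ler_wpM2l.
have mX l : `|X 0 l| <= rho * S by rewrite mxE mulrC; exact: wsum.
have h1 := sqn_le_coord mX.
have d0 : 0 <= d%:R :> R by [].
pose A := 1 + d%:R * rho ^+ 2.
have A0 : 0 <= A by rewrite addr_ge0// mulr_ge0// ltW.
have hu : u0 X <= C * A * (1 + S) ^+ 2.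
  apply: (le_trans (ler_norm _)); apply: (le_trans (u0_growth X)).
  rewrite -mulrA ler_pM2l// /A.
  have -> : (1 + d%:R * rho ^+ 2) * (1 + S) ^+ 2 = (1 + S) ^+ 2 +
      d%:R * rho ^+ 2 * (1 + S) ^+ 2 by ring.
  apply: lerD; first by nra.
  apply: (le_trans h1); rewrite exprMn mulrA ler_wpM2l//; last by nra.
  by rewrite mulr_ge0// ltW.
have hv : - (C * A * (1 + S) ^+ 2) <= \sum_i a i * u0 (y i).
  have : `|\sum_i a i * u0 (y i)| <= S * (C * A).
    apply: wsum => i; apply: (le_trans (u0_growth _)).
    by rewrite ler_pM2l// lerD2l; exact: sqn_le_coord.
  rewrite ler_norml => /andP[+ _]; apply: le_trans.
  rewrite lerN2 mulrC ler_wpM2l//; last by nra.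
  by rewrite mulr_ge0// ltW.
have hw : - (d%:R * rho ^+ 2 * (1 + S) ^+ 2) <= \sum_l wvar y a l.
  have -> : - (d%:R * rho ^+ 2 * (1 + S) ^+ 2) = \sum_(l < d) - (rho ^+ 2 * (1 + S) ^+ 2).
    by rewrite sumr_const card_ord -mulr_natl; ring.
  apply: ler_sum => l _; rewrite /wvar.
  have : `|\sum_i a i * y i 0 l ^+ 2| <= S * rho ^+ 2.
    by apply: wsum => i; rewrite normrX ler_pXn2r ?nnegrE// ltW.
  rewrite ler_norml => /andP[+ _].
  have : wmean y a l ^+ 2 <= (rho * S) ^+ 2.
    rewrite -(real_normK (num_real _)) ler_pXn2r ?nnegrE// ?mulr_ge0// ?(ltW rho0)//.
    by have := mX l; rewrite mxE.
  rewrite exprMn; nra.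
have : L * - (d%:R * rho ^+ 2 * (1 + S) ^+ 2) <= L * \sum_l wvar y a l.
  by rewrite ler_pM2l.
move: hu hv; rewrite /A; lra.
Qed.

End weights_terminal.

Lemma minn_phase_end a k n : (n + a <= k)%N -> minn (k - a) n = n.
Proof. lia. Qed.

Lemma minn_phase_in a k n : (a <= k)%N -> (k < n + a)%N ->
  minn (k.+1 - a) n = (minn (k - a) n).+1.
Proof. lia. Qed.

Lemma minn_phase_out a k n : (k < a)%N || (n + a <= k)%N ->
  minn (k.+1 - a) n = minn (k - a) n.
Proof. lia. Qed.

(** * The discretized control and its cost *)

Section value_upper_bound.
Context {R : realType} {d : nat} {disp : measure_display}
  {T : measurableType disp} (P : probability T R) (W : R -> T -> 'rV[R]_d).
Hypothesis bW : is_brownian P W.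
Variables (u0 : 'rV[R]_d -> R) (L C : R).
Hypotheses (L0 : 0 < L) (C0 : 0 < C).
Hypothesis u0_cont : continuous u0.
Hypothesis u0_taylor :
  forall x k, `|u0 (x + k) - u0 x - dotv (grad u0 x) k| <= L * sqn k.
Hypothesis u0_growth : forall x, `|u0 x| <= C * (1 + sqn x).
Context {I : finType}.
Variables (i0 : 'I_d) (y : I -> 'rV[R]_d) (lam0 : I -> R) (rho : R).
Hypothesis rho0 : 0 < rho.
Hypothesis y_rho : forall i l, `|y i 0 l| <= rho.
Hypotheses (lam0_ge0 : forall i, 0 <= lam0 i) (lam0_sum : \sum_i lam0 i = 1).

Let d0 : (0 < d)%N.
Proof. exact: leq_ltn_trans (leq0n _) (ltn_ord i0). Qed.

Let dR0 : 0 < d%:R :> R.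
Proof. by rewrite ltr0n. Qed.

(** Each drift is then at most $1/d$, so the single nonzero column of the control has squared norm
    at most $1/d \le 1$. *)
Let kap0 : R := (rho * d%:R)^-1.

Let kap00 : 0 < kap0.
Proof. by rewrite invr_gt0 mulr_gt0. Qed.

Section discretization.
Variables (n : nat) (t eta : R).
Hypotheses (n0 : (0 < n)%N) (t0 : 0 < t) (eta0 : 0 < eta).

Let N := (d * n)%N.
Let h : R := t / N%:R.
Let NR0 : 0 < N%:R :> R.
Proof. by rewrite ltr0n muln_gt0 d0. Qed.
Let h0 : 0 < h.
Proof. by rewrite divr_gt0. Qed.

(* During the l-th of d phases of n steps, the variance of the l-th coordinate
   is reduced. *)
Let jj (k : nat) : 'I_d := insubd i0 (k %/ n)%N.

Local Notation weight := (weight W i0 y lam0 kap0 eta h jj).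
Local Notation drift := (drift W i0 y lam0 kap0 eta h jj).
Local Notation mvar := (mvar P W i0 y lam0 kap0 eta h jj).

Let e : @elementary R d disp T := Elementary N (fun k => k%:R * h)
  (fun k w => Num.sqrt 2 *: \matrix_(l, m) (if m == i0 then drift k l w else 0)).

Let coef_bound k w : mxfrob (el_coef e k w) <= Num.sqrt 2.
Proof.
rewrite /= mxfrobZ ger0_norm ?sqrtr_ge0// ler_piMr ?sqrtr_ge0//.
rewrite mxfrob_le// expr1n.
apply: (@le_trans _ _ (\sum_(l < d) (rho * kap0) ^+ 2)).
  apply: ler_sum => l _; rewrite (bigD1 i0)//= big1 => [|m /negbTE mi].
    rewrite addr0 mxE eqxx -(real_normK (num_real _)).
    rewrite ler_pXn2r ?nnegrE ?mulr_ge0 ?(ltW rho0) ?(ltW kap00)//.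
    exact: drift_bounded.
  by rewrite mxE mi expr0n.
rewrite sumr_const card_ord -mulr_natl /kap0.
have -> : d%:R * (rho * (rho * d%:R)^-1) ^+ 2 = d%:R^-1 :> R.
  by field; rewrite !gt_eqF.
by rewrite invf_le1// ler1n.
Qed.

Let e_elementary : is_elementary W t e.
Proof.
split.
- by rewrite /= mul0r.
- by rewrite /= /h mulrC mulfVK// gt_eqF.
- by move=> k _ /=; rewrite ler_pM2r// ler_nat.
- move=> k l m _ /=.
  rewrite (_ : (fun w => _) = fun w => Num.sqrt 2 *
      (if m == i0 then drift k l w else 0)); last first.
    by apply/funext => w; rewrite !mxE.
  apply: measurable_funM; first exact: measurable_cst.
  case: (m == i0); last exact: measurable_cst.
  exact: drift_adapted.
- by exists (Num.sqrt 2) => k w _; exact: coef_bound.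
Qed.

(** The control is the drift of the mean, so the state is the barycenter of the current weights on
    every path, without discretization error. *)
Let e_int w : \sum_i lam0 i *: y i + el_int W e w = \row_l wmean y (weight N w) l.
Proof.
apply/rowP => l; rewrite mxE el_int_coord summxE mxE.
have -> : \sum_i (lam0 i *: y i) 0 l = wmean y lam0 l.
  by apply: eq_bigr => i _; rewrite mxE.
have E k : \sum_(m < d) el_coef e k w l m *
    incr W (el_time e k) (el_time e k.+1) m w =
    drift k l w * noise W i0 h k w.
  rewrite (bigD1 i0)//= big1 => [|m /negbTE mi]; last by rewrite !mxE mi mulr0 mul0r.
  by rewrite addr0 !mxE eqxx /noise; ring.
under eq_bigr do rewrite E.
rewrite [el_size e]/=.
elim: N => [|k ih]; first by rewrite big_ord0 addr0.
by rewrite big_ord_recr/= addrA ih wstep_mean.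
Qed.

Let K4 : R := 9 * wbound rho kap0 eta ^+ 4.
Let K4_ge0 : 0 <= K4.
Proof. by rewrite /K4 mulr_ge0// exprn_even_ge0. Qed.
Let beta : R := K4 * (N%:R * (228 * h ^+ 2)).
Let h2_ge0 : 0 <= 228 * h ^+ 2.
Proof. by rewrite mulr_ge0 ?sqr_ge0. Qed.

Let dead_le k : (k <= N)%N -> Ex P (fun w => wdead (weight k w)) <= beta.
Proof.
move=> kN.
have [_ le] := wdead_moment bW i0 jj rho0 kap00 eta0 h0 y_rho lam0_ge0 lam0_sum k.
apply: (le_trans le); rewrite -/K4 /beta; apply: (ler_wpM2l K4_ge0).
by apply: (ler_wpM2r h2_ge0); rewrite ler_nat.
Qed.

Let alpha : R := 2 * h / 3 * kap0 ^+ 2.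
Hypothesis alpha_le1 : alpha <= 1.

(** Geometric contraction towards $\eta + \rho^2\beta$. The exponent counts, by truncated
    subtraction, the steps of phase [l] already done; in other phases the variance just does not
    increase. *)
Let mvar_terminal l :
  mvar N l - (eta + rho ^+ 2 * beta) <= (1 - alpha) ^+ n * rho ^+ 2.
Proof.
have beta0 : 0 <= beta.
  exact: (mulr_ge0 K4_ge0 (mulr_ge0 (ltW NR0) h2_ge0)).
have alpha0 : 0 <= alpha.
  by rewrite mulr_ge0 ?sqr_ge0// divr_ge0// mulr_ge0// ltW.
suff H k : (k <= N)%N -> mvar k l - (eta + rho ^+ 2 * beta) <=
    (1 - alpha) ^+ (minn (k - l * n) n) * rho ^+ 2.
  have {1}<- : minn (N - l * n) n = n.
    by apply: minn_phase_end; rewrite -mulSn leq_mul2r ltn_ord orbT.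
  exact: H.
elim: k => [|k ih] kN.
  rewrite sub0n min0n expr0 mul1r (_ : mvar 0 l = wvar y lam0 l); last exact: (Ex_cst P (wvar y lam0 l)).
  have := alive_wvar_le rho0 y_rho lam0_ge0 lam0_sum l.
  have := mulr_ge0 (sqr_ge0 rho) beta0.
  have := eta0; lra.
have {}ih := ih (ltnW kN).
have kn1 : (k %/ n * n <= k)%N by rewrite leq_trunc_div.
have kn2 : (k < (k %/ n).+1 * n)%N by rewrite ltn_ceil.
have kd : (k %/ n < d)%N by rewrite ltn_divLR.
have jjE : jj k = (k %/ n)%N :> nat by rewrite /jj val_insubd kd.
have [jl|jl] := eqVneq (jj k) l.
  have -> : minn (k.+1 - l * n) n = (minn (k - l * n) n).+1.
    by apply: minn_phase_in; [move: kn1|move: kn2]; rewrite -jjE jl// mulSn.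
  rewrite (exprS (1 - alpha)) -mulrA; apply: (@le_trans _ _ ((1 - alpha) *
      (mvar k l - (eta + rho ^+ 2 * beta)))); last first.
    by rewrite ler_wpM2l// subr_ge0.
  have := mvar_contract bW i0 jj rho0 kap00 eta0 h0 y_rho lam0_ge0 lam0_sum k.
  rewrite jl -/alpha.
  have : alpha * (rho ^+ 2 * Ex P (fun w => wdead (weight k w))) <=
      alpha * (rho ^+ 2 * beta).
    by rewrite ler_wpM2l// ler_wpM2l ?sqr_ge0//; apply: dead_le; exact: ltnW.
  by rewrite /alpha; lra.
have -> : minn (k.+1 - l * n) n = minn (k - l * n) n.
  apply: minn_phase_out; rewrite -mulSn.
  move: jl; rewrite -val_eqE/= jjE neq_ltn => /orP[lt|lt]; apply/orP; [left|right].
    by apply: (leq_trans kn2); rewrite leq_mul2r lt orbT.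
  by apply: leq_trans kn1; rewrite leq_mul2r lt orbT.
apply: le_trans ih; rewrite lerD2r.
exact: (mvar_nincr bW i0 jj rho0 kap00 eta0 h0 y_rho lam0_sum k l).
Qed.

Lemma value_discretization v :
  (forall x, v x <= u0 x) ->
  (forall x e, 0 < e ->
    exists p, forall k, v x + dotv p k - e * (1 + sqn k) <= v (x + k)) ->
  value P W u0 t (\sum_i lam0 i *: y i) <= \sum_i lam0 i * u0 (y i) +
    L * d%:R * (eta + rho ^+ 2 * beta + (1 - alpha) ^+ n * rho ^+ 2) +
    (2 * C * (1 + d%:R * rho ^+ 2) + L * d%:R * rho ^+ 2) * beta.
Proof.
move=> vu vsub.
set C' := 2 * C * _ + _.
have C'0 : 0 <= C'.
  have dr : 0 <= d%:R * rho ^+ 2 by rewrite mulr_ge0 ?sqr_ge0 ?(ltW dR0).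
  apply: addr_ge0; last by rewrite -mulrA mulr_ge0// ltW.
  by apply: mulr_ge0; [rewrite mulr_ge0// ltW|rewrite addr_ge0].
have ce : controlled P W t (el_int W e).
  have [sigma sp] := elementary_control bW e_elementary (fun k w _ => coef_bound k w).
  by exists sigma.
have := value_le bW u0_cont u0_growth vu vsub (\sum_i lam0 i *: y i) (ltW t0) ce.
move=> /le_trans; apply.
under [X in Ex P X]eq_fun do rewrite e_int.
have lw i : L1 P (fun w => weight N w i).
  apply: L2_L1; exact: (weight_L2 bW i0 jj rho0 kap00 eta0 h0 y_rho lam0_sum).
have lv l : L1 P (fun w => wvar y (weight N w) l).
  exact: (wvar_L1 bW i0 jj rho0 kap00 eta0 h0 y_rho lam0_sum).
have [ld _] := wdead_moment bW i0 jj rho0 kap00 eta0 h0 y_rho lam0_ge0 lam0_sum N.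
have l1 : L1 P (fun w => \sum_i weight N w i * u0 (y i)).
  by apply: L1_sum => i; under eq_fun do rewrite mulrC; exact: L1Z.
have l2 : L1 P (fun w => L * \sum_l wvar y (weight N w) l).
  by apply: L1Z; exact: L1_sum.
have l3 : L1 P (fun w => C' * wdead (weight N w)) by exact: L1Z.
apply: (@le_trans _ _ (Ex P (fun w => \sum_i weight N w i * u0 (y i) +
    L * \sum_l wvar y (weight N w) l + C' * wdead (weight N w)))).
  apply: Ex_le.
  - under eq_fun do rewrite -e_int.
    have [le _] := controlled_moments bW ce.
    exact: rvL2_u0 u0_cont u0_growth _ _ le.
  - by apply: L1D => //; exact: L1D.
  - move=> w; apply: weights_terminal => //; exact: weight_sum.
rewrite ExD//; last exact: L1D.
rewrite ExD// ExZ; last exact: L1_sum.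
rewrite ExZ//.
apply: lerD; last by rewrite ler_wpM2l//; exact: dead_le.
apply: lerD.
  rewrite Ex_sum => [|i]; last by under eq_fun do rewrite mulrC; exact: L1Z.
  apply: ler_sum => i _; under eq_fun do rewrite mulrC.
  rewrite ExZ// mulrC (weight_mean bW i0 jj rho0 kap00 eta0 h0 y_rho lam0_sum)//.
rewrite -mulrA ler_pM2l// Ex_sum//.
set Z := eta + _ + _.
have -> : d%:R * Z = \sum_(l < d) Z by rewrite sumr_const card_ord -[RHS]mulr_natl.
apply: ler_sum => l _; have := mvar_terminal l.
have -> : Ex P (fun w => wvar y (weight N w) l) = mvar N l by [].
by rewrite /Z; lra.
Qed.

End discretization.

(** The errors of the discretization can be made smaller than any [z]; the constants left depend on
    [rho], [L] and [d], not on the number of points. *)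
Lemma value_le_hull v t :
  (forall x, v x <= u0 x) ->
  (forall x e, 0 < e ->
    exists p, forall k, v x + dotv p k - e * (1 + sqn k) <= v (x + k)) ->
  0 < t ->
  value P W u0 t (\sum_i lam0 i *: y i) <= \sum_i lam0 i * u0 (y i) +
    L * d%:R * rho ^+ 2 * expR (- (2 * kap0 ^+ 2 / (3 * d%:R)) * t).
Proof.
move=> vu vsub t0; apply/ler_addgt0Pr => z z0.
have Ld : 0 < L * d%:R by rewrite mulr_gt0.
pose eta := z / 2 / (L * d%:R).
have eta0 : 0 < eta by rewrite !divr_gt0.
pose C' := 2 * C * (1 + d%:R * rho ^+ 2) + L * d%:R * rho ^+ 2.
pose B := 9 * wbound rho kap0 eta ^+ 4 * (228 * t ^+ 2).
have B0 : 0 <= B.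
  by rewrite /B mulr_ge0 ?(mulr_ge0 _ (sqr_ge0 _)) ?(mulr_ge0 _ (exprn_even_ge0 _ _)).
have dr : 0 <= d%:R * rho ^+ 2 by rewrite mulr_ge0 ?sqr_ge0 ?(ltW dR0).
have C'0 : 0 <= C'.
  apply: addr_ge0; last by rewrite -mulrA mulr_ge0// ltW.
  by apply: mulr_ge0; [rewrite mulr_ge0// ltW|rewrite addr_ge0].
pose D := L * d%:R * rho ^+ 2 + C'.
have D0 : 0 <= D by rewrite /D addr_ge0// mulr_ge0 ?sqr_ge0// ltW.
have k2 : 0 < kap0 ^+ 2 by rewrite exprn_gt0.
have DBz : 0 <= D * B * 2 / z.
  by rewrite divr_ge0 ?(ltW z0)// mulr_ge0// mulr_ge0.
(* The first term forces $D\beta \le z/2$, the second $\alpha \le 1$. *)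
pose A := D * B * 2 / z + t * kap0 ^+ 2.
have A0 : 0 <= A.
  by rewrite /A addr_ge0// mulr_ge0 ?(ltW t0) ?(ltW k2).
pose n := (Num.truncn A).+1.
have nA : A < n%:R by exact: truncnS_gt.
have n0 : (0 < n)%N by [].
have nR0 : 0 < n%:R :> R by rewrite ltr0n.
have d1 : 1 <= d%:R :> R by rewrite ler1n.
have hE : t / (d * n)%N%:R = t / (d%:R * n%:R) by rewrite natrM.
have alpha1 : 2 * (t / (d * n)%N%:R) / 3 * kap0 ^+ 2 <= 1.
  rewrite hE.
  have -> : 2 * (t / (d%:R * n%:R)) / 3 * kap0 ^+ 2 =
    (2 * (t * kap0 ^+ 2)) / (3 * (d%:R * n%:R)) by field; rewrite !gt_eqF.
  rewrite ler_pdivrMr ?mulr_gt0// mul1r.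
  have : t * kap0 ^+ 2 <= n%:R.
    by apply: ltW; apply: le_lt_trans nA; rewrite /A lerDr.
  have := ltW nR0; have := mulr_gt0 t0 k2; nra.
have := value_discretization n0 t0 eta0 alpha1 vu vsub.
move=> /le_trans; apply.
rewrite -/C'.
set beta := 9 * _ * _.
have beta_le : beta <= B / n%:R.
  rewrite /beta /B natrM.
  set K4 := 9 * _.
  have -> : K4 * (d%:R * n%:R * (228 * (t / (d%:R * n%:R)) ^+ 2)) =
     K4 * (228 * t ^+ 2) / n%:R / d%:R by field; rewrite !gt_eqF.
  by rewrite ler_pdivrMr// ler_peMr// divr_ge0// ltW.
have DB : D * beta <= z / 2.
  apply: (le_trans (ler_wpM2l D0 beta_le)).
  rewrite mulrA ler_pdivrMr//.
  have : D * B * 2 / z < n%:R.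
    by apply: le_lt_trans nA; rewrite /A lerDl mulr_ge0// ltW.
  by rewrite ltr_pdivrMr//; lra.
set alpha := 2 * _ / 3 * _ in alpha1 *.
(* Each coordinate contracts during a [d]-th of the time only, hence the factor [d] in the rate. *)
have pow : (1 - alpha) ^+ n <= expR (- (2 * kap0 ^+ 2 / (3 * d%:R)) * t).
  have -> : - (2 * kap0 ^+ 2 / (3 * d%:R)) * t = (- alpha) *+ n.
    by rewrite -mulr_natr /alpha hE; field; rewrite !gt_eqF.
  rewrite -mulr_natl expRM_natl ler_pXn2r ?nnegrE ?subr_ge0 ?expR_ge0//.
  exact: expR_ge1Dx.
have : L * d%:R * (rho ^+ 2 * (1 - alpha) ^+ n) <=
    L * d%:R * (rho ^+ 2 * expR (- (2 * kap0 ^+ 2 / (3 * d%:R)) * t)).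
  by rewrite ler_pM2l// ler_pM2l// exprn_gt0.
have eE : L * d%:R * eta = z / 2 by rewrite /eta mulrC divfK// gt_eqF.
move: DB; rewrite /D; lra.
Qed.

End value_upper_bound.

(** * Convergence of the flow *)

Lemma superlinear_min (R : realType) (d : nat) (f : 'rV[R]_d -> R) :
  continuous f -> superlinear f -> exists y, forall x, f y <= f x.
Proof.
move=> cf sl; have [r [r0 hr]] := sl `|f 0|.
(* Outside the box the Euclidean norm exceeds [r] and 1, so $f(x) > |f(0)|\,|x| \ge f(0)$. *)
pose M := Num.max r 1.
have [|||y _ hy] := @compact_EVT_min _ R f [set x : 'rV[R]_d | forall i, `|x 0 i| <= M].
- by exists 0 => i; rewrite mxE normr0 le_max ler01 orbT.
- exact: compact_coord_box.
- exact: continuous_subspaceT.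
exists y => x.
have [/forallP inbox|] := boolP [forall i, `|x 0 i| <= M].
  by apply: hy; rewrite inE => i; exact: inbox.
rewrite negb_forall => /existsP[i]; rewrite -ltNge => xi.
have Mx : M < enorm x.
  apply: (lt_le_trans xi); rewrite -(@ler_pXn2r _ 2)// ?nnegrE ?enorm_ge0//.
  by rewrite real_normK ?num_real// enorm_sqn sqn_coord.
have rx : r < enorm x by apply: le_lt_trans Mx; rewrite le_max lexx.
have x1 : 1 < enorm x by apply: le_lt_trans Mx; rewrite le_max lexx orbT.
have := hr x rx; rewrite ltr_pdivlMr ?(lt_trans ltr01)// => h.
have : f y <= f 0.
  by apply: hy; rewrite inE => j; rewrite mxE normr0 le_max ler01 orbT.
move=> /le_trans; apply; apply: (le_trans (ler_norm _)); apply: le_trans (ltW h).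
by rewrite ler_peMr// ltW.
Qed.

Theorem theorem6p1 (R : realType) (d : nat) (d_ge1 : (1 <= d)%N)
  (disp : measure_display) (T : measurableType disp) (P : probability T R)
  (W : R -> T -> 'rV[R]_d) (W_brownian : is_brownian P W)
  (u0 u0cc : 'rV[R]_d -> R)
  (u0_C11 : C11 u0)
  (u0_superlinear : superlinear u0)
  (u0cc_envelope : is_convex_envelope u0 u0cc)
  (R0 : R) (R0_gt0 : 0 < R0)
  (u0_eq_outside : forall x : 'rV[R]_d, R0 < enorm x -> u0 x = u0cc x)
  (x0 : 'rV[R]_d) (xi : R -> 'rV[R]_d)
  (xi_flow : is_gradient_flow (value P W u0) x0 xi) :
  exists y : 'rV[R]_d,
    (xi t @[t --> +oo] --> y) /\ (forall z : 'rV[R]_d, u0cc y <= u0cc z).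
Proof.
have [L L0 taylor] := C11_taylor u0_C11.
have [C C0 growth] := taylor_growth taylor.
have cu0 : continuous u0.
  by move=> x; apply: differentiable_continuous; case: u0_C11.
have [y0 y0min] := superlinear_min cu0 u0_superlinear.
have [cv vu vmax] := u0cc_envelope.
have vsub := envelope_subgradient L0 y0min taylor u0cc_envelope.
have vmin z : u0cc y0 <= u0cc z.
  apply: (le_trans (vu y0)); apply: (vmax (cst (u0 y0))) => //.
  by apply/convex_function_lerP => ? ? s _ _ /=; lra.
(* The cut at the sphere needs $u_0 = u_0^{**}$ on the sphere too, while the hypothesis only covers
   the points strictly beyond [R0]. *)
pose rho := R0 + 1.
have rho0 : 0 < rho by rewrite addr_gt0.
have dR0 : 0 < d%:R :> R by rewrite ltr0n.
pose c := 2 * (rho * d%:R)^-1 ^+ 2 / (3 * d%:R).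
have c0 : 0 < c by rewrite divr_gt0 ?mulr_gt0 ?exprn_gt0 ?invr_gt0 ?mulr_gt0.
pose K := L * d%:R * rho ^+ 2.
have K0 : 0 < K by rewrite !mulr_gt0 ?exprn_gt0.
have v_le_value t x : 0 < t -> u0cc x <= value P W u0 t x.
  by move=> /ltW t0; exact: (value_ge W_brownian cu0 growth vu vsub).
have value_le_v t x : 0 < t -> value P W u0 t x <= u0cc x + K * expR (- c * t).
  move=> t0; have [xrho|rhox] := lerP (enorm x) rho; last first.
    have xR0 : R0 < enorm x by apply: le_lt_trans rhox; rewrite lerDl.
    have := value_le_u0 W_brownian cu0 growth vu vsub x (ltW t0).
    rewrite u0_eq_outside// => /le_trans; apply.
    by rewrite lerDl mulr_ge0 ?expR_ge0// ltW.
  apply/ler_addgt0Pr => z z0.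
  have out y : rho <= enorm y -> u0 y = u0cc y.
    by move=> yrho; apply: u0_eq_outside; apply: lt_le_trans yrho; rewrite ltrDl.
  have := hull_epi_ball cv rho0 vu out (envelope_hull_epi y0min u0cc_envelope x z0) xrho.
  move=> /hull_epi_finite[I [lam [y [lam_ge0 lam1 yball <- yle]]]].
  have y_rho i l : `|y i 0 l| <= rho.
    rewrite (le_trans _ (yball i))//.
    rewrite -(@ler_pXn2r _ 2)// ?nnegrE ?enorm_ge0//.
    by rewrite real_normK ?num_real// enorm_sqn sqn_coord.
  have := value_le_hull W_brownian L0 C0 cu0 taylor growth (Ordinal d_ge1) rho0
    y_rho lam_ge0 lam1 vu vsub t0.
  by rewrite -/c -/K => /le_trans; apply; lra.
have [_ _ flow] := xi_flow.
apply: (@perturbed_convex_flow_cvg _ _ u0cc xi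
  (fun t => grad (value P W u0 t) (xi t)) y0 (K + L) (c / 2)) => //.
- by rewrite addr_gt0.
- by rewrite divr_gt0.
- by move=> t /flow[].
move=> t y t0; have [du _] := flow t t0.
(* This step length balances the errors: after division by [s], the gap $K e^{-ct} = K s^2$ and the
   semiconcavity term $L s^2 |k|^2$ are both of order [s]. *)
set x := xi t; set k := y - x; set s := expR (- (c / 2) * t).
have s0 : 0 < s by exact: expR_gt0.
have sE : expR (- c * t) = s ^+ 2.
  by rewrite /s -expRM_natl; congr expR; field.
have h1 := three_points_grad du s0 (fun r r0 =>
  value_three_points W_brownian cu0 taylor growth vu vsub x k (ltW t0) r0 s0).
have h2 := value_le_v t x t0; rewrite sE in h2.
have h3 := v_le_value t (x - s *: k) t0.
have s1 : 0 < 1 + s by rewrite addr_gt0.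
have h4 : (1 + s) * u0cc x <= u0cc (x - s *: k) + s * u0cc y.
  move/convex_function_lerP : cv => /(_ (x - s *: k) y (1 + s)^-1).
  rewrite invr_ge0 (ltW s1) invf_le1// lerDl (ltW s0) => /(_ isT isT).
  have -> : (1 + s)^-1 *: (x - s *: k) + (1 - (1 + s)^-1) *: y = x.
    by apply/rowP => i; rewrite /k !mxE; field; rewrite gt_eqF.
  rewrite -(ler_pM2l s1) => /le_trans; apply.
  rewrite le_eqVlt; apply/orP; left; apply/eqP; field.
  by rewrite gt_eqF.
rewrite -(ler_pM2l s0).
have := sqn_ge0 k; have s2 := exprn_gt0 2 s0.
have := mulr_ge0 (ltW L0) (ltW s2); have := mulr_ge0 (ltW K0) (ltW s2).
have := sqn_ge0 k => q0 K2 L2.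
have : 0 <= K * s ^+ 2 * sqn k by rewrite mulr_ge0.
rewrite /= in h1 *; lra.
Qed.
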